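(* Let $\ell\in\mathbb{Z}_{\ge 0}$. If $g(w)=\mu w+w_0$, where $\mu\in\mathbb{R}_{>0}\setminus\{1\}$ and $w_0\in\mathbb{C}_+$, then the composition operator $C_{g,\max}$ on $\mathbb{B}_\ell(\mathbb{C}_+)$ is never complex symmetric; that is, there is no conjugation $\mathcal{C}$ on $\mathbb{B}_\ell(\mathbb{C}_+)$ with $C_{g,\max}=\mathcal{C}C_{g,\max}^*\mathcal{C}$.
   Context: $\mathbb{C}_+=\{z\in\mathbb{C}:\operatorname{Re}z>0\}$. For $\ell\in\mathbb{Z}_{\ge0}$, the weighted Bergman space $\mathbb{B}_\ell(\mathbb{C}_+)$ is the Hilbert space of analytic functions $h:\mathbb{C}_+\to\mathbb{C}$ with $\|h\|^2=\frac1\pi\int_{-\infty}^{\infty}\int_0^\infty x^\ell|h(x+iy)|^2\,dx\,dy<\infty$. For an analytic self-map $g$ of $\mathbb{C}_+$, the composition operator $C_{g,\max}$ has domain $\{h\in\mathbb{B}_\ell(\mathbb{C}_+):h\circ g\in\mathbb{B}_\ell(\mathbb{C}_+)\}$ and acts by $C_{g,\max}h=h\circ g$. A conjugation is an anti-linear isometric involution. *)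

(* Defs.v *)
From HB Require Import structures.
From mathcomp Require Import all_boot all_order all_algebra.
From mathcomp Require Import all_classical all_reals all_analysis.
From mathcomp Require Import complex.
Set Implicit Arguments.
Unset Strict Implicit.
Unset Printing Implicit Defensive.
Import Order.TTheory GRing.Theory Num.Theory.
Import numFieldNormedType.Exports.

Local Open Scope classical_set_scope.
Local Open Scope ring_scope.
Local Open Scope complex_scope.

Section HalfPlane.
Variable R : realType.

Definition halfplane : Type := {z : R[i] | 0 < complex.Re z}.

(* Functions are defined on the half-plane only, so that Leibniz equality of
   functions is equality on the half-plane. *)
Definition hfun : Type := halfplane -> R[i].

(* Analytic: the sum of a convergent power series in a disc around each point.
   R[i]^o is R[i] with the topology of its modulus. *)
Definition analytic (h : hfun) : Prop :=
  forall z : halfplane, exists (a : nat -> R[i]) (r : R), 0 < r /\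
    forall w : halfplane, `|sval w - sval z| < r%:C ->
      series (fun n => a n * (sval w - sval z) ^+ n : R[i]^o) @ \oo
        --> (h w : R[i]^o).

(* h (x + iy), with the junk value 0 when x <= 0 *)
Definition at_xy (h : hfun) (p : R * R) : R[i] :=
  if insub (p.1 +i* p.2) is Some w then h w else 0.

Definition area :
    {measure set (measurableTypeR R * measurableTypeR R)%type -> \bar R} :=
  (@lebesgue_measure R \x @lebesgue_measure R)%E.

Definition rhp : set (measurableTypeR R * measurableTypeR R) :=
  [set p | 0 < p.1].

End HalfPlane.

Arguments area R : clear implicits.
Arguments rhp R : clear implicits.

Section Bergman.
Variables (R : realType) (l : nat).
Local Notation hfun := (hfun R).

Definition sqnorm (h : hfun) : \bar R :=
  ((pi^-1)%:E *
   \int[area R]_(p in rhp R)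
     (p.1 ^+ l * Normc.normc (at_xy h p) ^+ 2)%:E)%E.

Definition bergman : set hfun := [set h | analytic h /\ (sqnorm h < +oo)%E].

Definition bnorm (h : hfun) : R := Num.sqrt (fine (sqnorm h)).

Definition binner (h k : hfun) : R[i] :=
  let f p := at_xy h p * (at_xy k p)^*%C in
  (pi^-1 * \int[area R]_(p in rhp R) (p.1 ^+ l * complex.Re (f p)))
  +i* (pi^-1 * \int[area R]_(p in rhp R) (p.1 ^+ l * complex.Im (f p))).

(* A possibly unbounded operator T on the Bergman space is given by its graph:
   T h k means that h is in the domain of T and T h = k. *)
Definition operator : Type := hfun -> hfun -> Prop.

Definition op_eq (S T : operator) : Prop := forall h k, S h k <-> T h k.

Definition comp_max (g : halfplane R -> halfplane R) : operator :=
  fun h k => [/\ bergman h, bergman (h \o g) & k = h \o g].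

(* k is in the domain of T^* and T^* k = k'; for a densely defined T there is
   at most one such k'. *)
Definition adjoint (T : operator) : operator :=
  fun k k' => [/\ bergman k, bergman k' &
    forall h Th, T h Th -> binner Th k = binner h k'].

(* Only the values of J on the Bergman space matter. *)
Record conjugation (J : hfun -> hfun) : Prop := Conjugation {
  conj_stable : forall h, bergman h -> bergman (J h) ;
  conj_antilinear : forall (a : R[i]) h k, bergman h -> bergman k ->
    J (a *: h + k) = (a^*%C) *: J h + J k ;
  conj_isometric : forall h, bergman h -> bnorm (J h) = bnorm h ;
  conj_involutive : forall h, bergman h -> J (J h) = h }.

(* J T J: its domain consists of the h such that J h is in the domain of T. *)
Definition conjugate_by (J : hfun -> hfun) (T : operator) : operator :=
  fun h k => bergman h /\ exists2 k', T (J h) k' & k = J k'.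

Definition complex_symmetric (T : operator) : Prop :=
  exists J, conjugation J /\ op_eq T (conjugate_by J (adjoint T)).

End Bergman.

(* Main.v *)
Require Import Defs.
From HB Require Import structures.
From mathcomp Require Import all_boot all_order all_algebra.
From mathcomp Require Import all_classical all_reals all_analysis.
From mathcomp Require Import measurable_realfun complex.
From mathcomp Require Import ring lra.
Set Implicit Arguments.
Unset Strict Implicit.
Unset Printing Implicit Defensive.
Import Order.TTheory GRing.Theory Num.Theory.
Import numFieldNormedType.Exports.
Local Open Scope classical_set_scope.
Local Open Scope ring_scope.
Local Open Scope complex_scope.

(* Write h(z) = (z + conj w0) / mu.  The adjoint of C_g is
   mu^-(l+2) C_h: up to a change of variables this says that the translations
   z |-> z + a with a > 0 are self-adjoint.  The latter follows from Cauchy's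
   theorem for F(z + s + ie) conj(G(z + a - s + ie)), analytic in s + ie, on the
   rectangle [0, a] x [0, 1], integrated over z: invariance of the measure under
   imaginary translations makes the contributions of the two horizontal sides
   cancel.
   One of g and h is a contraction with a fixed point in the half-plane, and
   the other one, an expansion with fixed point -s, has the eigenvector
   K(z) = (z + s)^-(l+2).  If C_g = J C_g^* J, then J K is fixed by composition
   with the contraction, hence is constant, hence is 0, and so is K. *)

(** * Affine changes of variables in the plane *)

(** Dilations and imaginary translations map the half-plane onto itself and scale the measure by a
    constant, so their adjoints come from a change of variables. A real translation moves the
    half-plane into a proper part of itself and distorts the weight; this is why Cauchy's theorem
    enters. Domains raise no question: all the affine maps used are [z |-> c z + b] with [c > 0] and
    [Re b >= 0], and composition with them is bounded. Composition with an expansion of ratio [c]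
    that fixes [-s] multiplies [K] by [c^-(l+2)]. If [mu < 1], the expansion is h and this factor
    [mu^(l+2)] cancels the one in the adjoint, so [C_g^* K = K]. If [mu > 1], then
    [C_g K = mu^-(l+2) K]; the eigenvalue is real, so the antilinear J turns this into
    [C_g^* (J K) = mu^-(l+2) J K], that is, J K is fixed by composition with h. In both cases J K is
    fixed by the contraction. *)

Lemma pushforward_measureP d d' (T : measurableType d) (T' : measurableType d')
    (R : realType) (m : {measure set T -> \bar R}) (f : T -> T') :
  measurable_fun setT f ->
  exists pm : {measure set T' -> \bar R}, pm = pushforward m f :> (set T' ->
    \bar R).
Proof. by move=> mf; unshelve eexists (pushforward m f). Qed.

Section Affine.
Variable R : realType.
Local Notation leb := (@lebesgue_measure R).
Local Notation plane := (measurableTypeR R * measurableTypeR R)%type.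

Definition aff1 (c b x : R) : R := c * x + b.

Lemma measurable_aff1 (c b : R) :
  measurable_fun setT (aff1 c b : measurableTypeR R -> measurableTypeR R).
Proof. by apply: measurable_funD. Qed.

(** Lebesgue measure is determined by its values on the intervals []u, v]], where the scaling rule
    is a direct computation. *)
Lemma lebesgue_measure_aff1 (c b : R) (A : set (measurableTypeR R)) :
  0 < c -> measurable A -> leb A = (c%:E * leb (aff1 c b @^-1` A))%E.
Proof.
move=> c0 mA; have c0' : 0 <= c by exact: ltW.
have L (s t : R) :
    leb `]s, t]%classic = mule c%:E (leb `](s - b) / c, (t - b) / c]%classic).
  rewrite !lebesgue_measure_itv /= !lte_fin ltr_pM2r ?invr_gt0// ltrD2r.
  case: ifP => _; last by rewrite mule0.
  by rewrite -!EFinB -EFinM; congr EFin; field; rewrite gt_eqF.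
(* [pm] is the pushforward bundled as a measure, a form in which it can be scaled by [mscale] and
   compared by uniqueness. *)
have [pm pmE] := pushforward_measureP leb (measurable_aff1 c b).
rewrite (@lebesgue_measure_unique R (mscale (NngNum c0') pm)) //.
  by rewrite /= /mscale /= pmE.
move=> _ [[u v] _ <-] /=; rewrite /mscale /= pmE /pushforward.
have -> : aff1 c b @^-1` `]u, v] = `](u - b) / c, (v - b) / c]%classic.
  by apply/seteqP; split => x /=; rewrite !in_itv/= /aff1;
    rewrite ltr_pdivrMr// ler_pdivlMr// ltrBlDr lerBrDr mulrC.
exact: L.
Qed.

Definition aff2 (c b e : R) (p : plane) : plane :=
  (aff1 c b p.1, aff1 c e p.2).

Lemma measurable_aff2 (c b e : R) : measurable_fun setT (aff2 c b e).
Proof.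
by apply/measurable_fun_pairP; split; apply: (measurableT_comp (measurable_aff1
  _ _)).
Qed.

Lemma area_aff2 (c b e : R) (A : set plane) :
  0 < c -> measurable A -> area R A = ((c ^+ 2)%:E * area R (aff2 c b e @^-1`
    A))%E.
Proof.
move=> c0 mA; have c20 : 0 <= c ^+ 2 by exact: sqr_ge0.
have [pm pmE] := pushforward_measureP (area R) (measurable_aff2 c b e).
transitivity (mscale (NngNum c20) pm A); last by rewrite /= /mscale /= pmE.
apply: product_measure_unique => // X Y mX mY;
  rewrite /= /mscale /= pmE /pushforward.
have -> : aff2 c b e @^-1` (X `*` Y) = (aff1 c b @^-1` X) `*` (aff1 c e @^-1`
  Y) by [].
rewrite [X in (_ * X)%E]product_measure1E; last 2 first.
- by rewrite -[X in measurable X]setTI; exact: measurable_aff1.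
- by rewrite -[X in measurable X]setTI; exact: measurable_aff1.
rewrite (lebesgue_measure_aff1 b c0 mX) (lebesgue_measure_aff1 e c0 mY).
by rewrite expr2 EFinM muleACA.
Qed.

Lemma ge0_integral_aff2 (c b e : R) (f : plane -> \bar R) :
  0 < c -> measurable_fun setT f -> (forall p, 0 <= f p)%E ->
  (\int[area R]_p f p = (c ^+ 2)%:E * \int[area R]_p f (aff2 c b e p))%E.
Proof.
move=> c0 mf f0; have c20 : 0 <= c ^+ 2 by exact: sqr_ge0.
have [pm pmE] := pushforward_measureP (area R) (measurable_aff2 c b e).
rewrite (eq_measure_integral (mscale (NngNum c20) pm)); last first.
  by move=> A mA _; rewrite (area_aff2 b e c0 mA) /= /mscale /= pmE.
rewrite ge0_integral_mscale//= pmE.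
rewrite ge0_integral_pushforward//.
exact: measurable_aff2.
Qed.

Lemma integrable_aff2 (c b e : R) (f : plane -> \bar R) :
  0 < c -> (area R).-integrable setT f ->
  (area R).-integrable setT (f \o aff2 c b e).
Proof.
move=> c0 /integrableP[mf foo]; apply/integrableP; split.
  exact: measurableT_comp (measurable_aff2 _ _ _).
move: foo; rewrite (ge0_integral_aff2 b e c0) //=; last exact: measurableT_comp.
have c2 : 0 < c ^+ 2 by rewrite exprn_gt0.
set I := (X in (_ * X < _)%E -> _); rewrite -[X in _ -> (X < _)%E]/I.
by case: I => [r| |]; rewrite ?ltry ?ltNyr// gt0_muley.
Qed.

Lemma integral_aff2 (c b e : R) (f : plane -> \bar R) :
  0 < c -> (area R).-integrable setT f ->
  (\int[area R]_p f p = (c ^+ 2)%:E * \int[area R]_p f (aff2 c b e p))%E.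
Proof.
move=> c0 intf; have [mf _] := integrableP _ _ _ intf.
have intg := integrable_aff2 b e c0 intf.
rewrite [X in (_ = _ * X)%E]integralE muleBr//;
  last exact: integrable_add_def intg.
rewrite [X in X = _]integralE; congr (_ - _)%E.
  rewrite (ge0_integral_aff2 b e c0 (measurable_funepos mf)); last first.
    by move=> p; apply: funepos_ge0.
  by congr (_ * _)%E; apply: eq_integral => p _; rewrite ?funeposE ?funenegE.
rewrite (ge0_integral_aff2 b e c0 (measurable_funeneg mf)); last first.
  by move=> p; apply: funeneg_ge0.
by congr (_ * _)%E; apply: eq_integral => p _; rewrite ?funeposE ?funenegE.
Qed.
End Affine.

(** * Cauchy's theorem on rectangles *)

Section Bisection.
Variable R : realType.

Record rect := Rect { lft : R; rgt : R; bot : R; top : R }.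

(** The edges of [r] are required to be in order, so [subrect s s] expresses that [s] is a genuine,
    possibly degenerate, rectangle. *)
Definition subrect (r s : rect) : Prop :=
  [/\ lft s <= lft r, lft r <= rgt r & rgt r <= rgt s] /\
  [/\ bot s <= bot r, bot r <= top r & top r <= top s].

Definition quadrant (r : rect) (i j : bool) : rect :=
  let mx := (lft r + rgt r) / 2 in let my := (bot r + top r) / 2 in
  Rect (if i then mx else lft r) (if i then rgt r else mx)
       (if j then my else bot r) (if j then top r else my).

Lemma subrect_quadrant r s i j : subrect r s -> subrect (quadrant r i j) s.
Proof.
move=> [[? ? ?] [? ? ?]]; rewrite /subrect /quadrant.
by case: i; case: j => /=; split; split; lra.
Qed.

Lemma rgt_quadrant r i j :
  rgt (quadrant r i j) - lft (quadrant r i j) = (rgt r - lft r) / 2.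
Proof. by case: i => /=; field. Qed.

Lemma top_quadrant r i j :
  top (quadrant r i j) - bot (quadrant r i j) = (top r - bot r) / 2.
Proof. by case: j => /=; field. Qed.

Lemma lft_quadrant r i j : lft r <= rgt r ->
  lft r <= lft (quadrant r i j) /\ rgt (quadrant r i j) <= rgt r.
Proof. by move=> ?; case: i => /=; split; lra. Qed.

Lemma bot_quadrant r i j : bot r <= top r ->
  bot r <= bot (quadrant r i j) /\ top (quadrant r i j) <= top r.
Proof. by move=> ?; case: j => /=; split; lra. Qed.

Variables (s : rect) (m : rect -> R).
Hypothesis mD : forall r, subrect r s ->
  m r = m (quadrant r false false) + m (quadrant r false true)
      + m (quadrant r true false) + m (quadrant r true true).

(** Picks a quadrant carrying at least a quarter of [|m r|]. The last branch needs no test: by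
    additivity the four quadrants cannot all fail. *)
Definition bisect (r : rect) : rect :=
  if `|m r| <= 4 * `|m (quadrant r false false)| then quadrant r false false
  else if `|m r| <= 4 * `|m (quadrant r false true)| then quadrant r false true
  else if `|m r| <= 4 * `|m (quadrant r true false)| then quadrant r true false
  else quadrant r true true.

Lemma bisectE r : exists i j, bisect r = quadrant r i j.
Proof. by rewrite /bisect; do ![case: ifP => _]; do 2 eexists. Qed.

Lemma bisect_large r : subrect r s -> `|m r| <= 4 * `|m (bisect r)|.
Proof.
move=> /mD mr; rewrite /bisect; case: ifPn => // h1; case: ifPn => // h2.
case: ifPn => // h3; rewrite -!ltNge in h1 h2 h3.
have := ler_normD (m (quadrant r false false) + m (quadrant r false true)
  + m (quadrant r true false)) (m (quadrant r true true)).
have := ler_normD (m (quadrant r false false) + m (quadrant r false true))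
  (m (quadrant r true false)).
have := ler_normD (m (quadrant r false false)) (m (quadrant r false true)).
by rewrite -mr; lra.
Qed.

Definition nested n := iter n bisect s.

Hypothesis ss : subrect s s.

Lemma subrect_nested n : subrect (nested n) s.
Proof.
elim: n => // n; rewrite /nested /=.
by have [i [j ->]] := bisectE (iter n bisect s); exact: subrect_quadrant.
Qed.

Lemma nested_width n : rgt (nested n) - lft (nested n) =
  (rgt s - lft s) / 2 ^+ n.
Proof.
elim: n => [|n IH]; first by rewrite expr0 divr1.
rewrite /nested /=; have [i [j ->]] := bisectE (iter n bisect s).
by rewrite rgt_quadrant IH exprSr invfM mulrA.
Qed.

Lemma nested_height n : top (nested n) - bot (nested n) =
  (top s - bot s) / 2 ^+ n.
Proof.
elim: n => [|n IH]; first by rewrite expr0 divr1.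
rewrite /nested /=; have [i [j ->]] := bisectE (iter n bisect s).
by rewrite top_quadrant IH exprSr invfM mulrA.
Qed.

Lemma nested_large n : `|m s| <= 4 ^+ n * `|m (nested n)|.
Proof.
elim: n => [|n IH]; first by rewrite expr0 mul1r.
apply: (le_trans IH); rewrite exprSr -mulrA ler_wpM2l ?exprn_ge0//.
exact/bisect_large/subrect_nested.
Qed.

Lemma nested_mono n k : (n <= k)%N ->
  [/\ lft (nested n) <= lft (nested k), rgt (nested k) <= rgt (nested n),
      bot (nested n) <= bot (nested k) & top (nested k) <= top (nested n)].
Proof.
move=> /subnKC <-; elim: (k - n)%N => [|d [a b c e]]; first by rewrite addn0.
rewrite addnS /nested /=; have [i [j ->]] := bisectE (iter (n + d) bisect s).
have [[_ lr _] [_ bt _]] := subrect_nested (n + d).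
have [a' b'] := lft_quadrant i j lr; have [c' e'] := bot_quadrant i j bt.
by split; [apply: le_trans a'|apply: le_trans b|apply: le_trans c'|apply:
  le_trans e].
Qed.

Lemma nested_point : exists x y, forall n,
  lft (nested n) <= x <= rgt (nested n) /\
  bot (nested n) <= y <= top (nested n).
Proof.
have lr n k : lft (nested n) <= rgt (nested k).
  have [a _ _ _] := nested_mono (leq_maxl n k).
  have [_ b _ _] := nested_mono (leq_maxr n k).
  have [[_ c _] _] := subrect_nested (maxn n k).
  exact: le_trans a (le_trans c b).
have bt n k : bot (nested n) <= top (nested k).
  have [_ _ a _] := nested_mono (leq_maxl n k).
  have [_ _ _ b] := nested_mono (leq_maxr n k).
  have [_ [_ c _]] := subrect_nested (maxn n k).
  exact: le_trans a (le_trans c b).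
exists (sup (range (lft \o nested))), (sup (range (bot \o nested))) => n.
split; apply/andP; split.
- apply: ub_le_sup; last by exists n.
  by exists (rgt (nested n)) => _ [k _ <-]; exact: lr.
- apply: ge_sup; first by exists (lft (nested 0)), 0%N.
  by move=> _ [k _ <-]; exact: lr.
- apply: ub_le_sup; last by exists n.
  by exists (top (nested n)) => _ [k _ <-]; exact: bt.
- apply: ge_sup; first by exists (bot (nested 0)), 0%N.
  by move=> _ [k _ <-]; exact: bt.
Qed.

(* Goursat's bisection argument *)
Lemma additive_rect_eq0 :
  (forall x y e, lft s <= x <= rgt s -> bot s <= y <= top s -> 0 < e ->
    exists2 d, 0 < d & forall r, subrect r s ->
      lft r <= x <= rgt r -> bot r <= y <= top r ->
      rgt r - lft r + (top r - bot r) < d ->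
      `|m r| <= e * (rgt r - lft r + (top r - bot r)) ^+ 2) ->
  m s = 0.
Proof.
move=> small; apply/eqP; rewrite -normr_le0 leNgt; apply/negP => m0.
have [x [y xy]] := nested_point.
pose L := rgt s - lft s + (top s - bot s).
have L0 : 0 <= L by move: ss => [[_ ? _] [_ ? _]]; rewrite /L; lra.
(* Chosen so that [e * L ^+ 2 < |m s|], the [+ 1] covering [L = 0]. At level [n] the factor [4 ^+ n]
   lost by bisection is exactly compensated by the square of the half-perimeter [L / 2 ^+ n]. *)
pose e := `|m s| / (L ^+ 2 + 1) / 2.
have L2 : 0 < L ^+ 2 + 1 by rewrite ltr_wpDl ?sqr_ge0.
have e0 : 0 < e by rewrite !divr_gt0.
have [//|//|d d0 sm] := small x y e _ _ e0;
  [exact: (xy 0%N).1|exact: (xy 0%N).2|].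
have [n nd] : exists n, L / 2 ^+ n < d.
  exists (Num.bound (L / d)).
  rewrite ltr_pdivrMr ?exprn_gt0// mulrC -ltr_pdivrMr//.
  apply: lt_le_trans (archi_boundP _) _; first by rewrite divr_ge0// ltW.
  by rewrite -natrX ler_nat ltnW// ltn_expl.
have LE : rgt (nested n) - lft (nested n) + (top (nested n) - bot (nested n)) =
  L / 2 ^+ n.
  by rewrite nested_width nested_height -mulrDl.
have := sm _ (subrect_nested n) (xy n).1 (xy n).2; rewrite LE => /(_ nd) h.
have := nested_large n; apply/negP; rewrite -ltNge.
apply: le_lt_trans (_ : 4 ^+ n * (e * (L / 2 ^+ n) ^+ 2) < _).
  by rewrite ler_wpM2l// exprn_ge0.
have -> : 4 ^+ n * (e * (L / 2 ^+ n) ^+ 2) = e * L ^+ 2.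
  have -> : 4 ^+ n = (2 ^+ n) ^+ 2 :> R by rewrite -exprM mulnC exprM;
    congr (_ ^+ _); ring.
  have : 2 ^+ n != 0 :> R by rewrite expf_neq0.
  by move: (2 ^+ n) => t t0; field.
have -> : e * L ^+ 2 = `|m s| * (L ^+ 2 / (L ^+ 2 + 1) / 2).
  by rewrite /e; field; rewrite gt_eqF.
rewrite -[X in _ < X]mulr1 ltr_pM2l// ltr_pdivrMr// ltr_pdivrMr//.
by have := sqr_ge0 L; lra.
Qed.

End Bisection.

Section IntervalIntegral.
Variable R : realType.
Local Notation leb := (@lebesgue_measure R).

Definition itg (f : R -> R) (a b : R) : R := \int[leb]_(t in `[a, b]) f t.

Lemma integrable_itv (f : R -> R) a b : {within `[a, b], continuous f} ->
  leb.-integrable `[a, b] (EFin \o f).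
Proof. by move=> cf; apply: continuous_compact_integrable => //;
  exact: segment_compact. Qed.

Lemma itgB (f g : R -> R) a b : {within `[a, b], continuous f} ->
  {within `[a, b], continuous g} ->
  itg (fun t => f t - g t) a b = itg f a b - itg g a b.
Proof. by move=> cf cg; apply: RintegralB => //; exact: integrable_itv. Qed.

Lemma itg_split (f : R -> R) a m b : {within `[a, b], continuous f} ->
  a <= m <= b -> itg f a b = itg f a m + itg f m b.
Proof.
move=> /integrable_itv cf /andP[am mb].
apply/eqP; rewrite addrC -subr_eq; apply/eqP.
rewrite /itg Rintegral_itvB //=.
apply: Rintegral_itv_obnd_cbnd; apply: integrableS cf => //.
by apply: subset_itvr; rewrite bnd_simp.
Qed.

Lemma itg_approx (f : R -> R) a b k C : {within `[a, b], continuous f} ->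
  a <= b -> (forall t, a <= t <= b -> `|f t - k| <= C) ->
  `|itg f a b - k * (b - a)| <= C * (b - a).
Proof.
move=> cf ab fk.
have J (c : R) : itg (fun=> c) a b = c * (b - a).
  rewrite /itg Rintegral_cst//= lebesgue_measure_itv /= lte_fin.
  by move: ab; rewrite le_eqVlt => /orP[/eqP ->|-> //]; rewrite ltxx subrr.
have cc (c : R) : {within `[a, b], continuous (fun=> c)}.
  by move=> ?; exact: cvg_cst.
have cfk : {within `[a, b], continuous (fun t => f t - k)}.
  by move=> x; apply: continuousB; [exact: cf|exact: cc].
rewrite -!J -itgB//.
apply: le_trans (le_normr_Rintegral _ _) _ => //; first exact: integrable_itv.
apply: le_Rintegral => //.
- by apply: integrable_itv => x; apply: continuous_comp (cfk x) _;
    exact: norm_continuous.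
- exact: integrable_itv.
Qed.

End IntervalIntegral.

Section Goursat.
Variables (R : realType) (U V : R -> R -> R) (s : rect R).

(* [U + iV] has complex derivative [p + iq] at [x + iy], relatively to [s] *)
Definition holo_at (x y : R) : Prop := exists p q, forall e, 0 < e ->
  exists2 d, 0 < d & forall x' y', lft s <= x' <= rgt s ->
    bot s <= y' <= top s -> `|x' - x| < d -> `|y' - y| < d ->
    `|U x' y' - (U x y + p * (x' - x) - q * (y' - y))|
      <= e * (`|x' - x| + `|y' - y|) /\
    `|V x' y' - (V x y + q * (x' - x) + p * (y' - y))|
      <= e * (`|x' - x| + `|y' - y|).

Hypothesis holo : forall x y, lft s <= x <= rgt s -> bot s <= y <= top s ->
  holo_at x y.

(** Continuity from a first-order expansion. The linear form is arbitrary because [U] needs the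
    coefficients [p, -q] and [V] needs [q, p]. *)
Lemma linear_approx_small (W k l e : R) : 0 < e ->
  exists2 r, 0 < r & forall u v w, `|u| < r -> `|v| < r ->
    `|w - (W + k * u + l * v)| <= 1 * (`|u| + `|v|) -> `|W - w| < e.
Proof.
move=> e0; pose r := e / (`|k| + `|l| + 2) / 2.
have k0 : 0 < `|k| + `|l| + 2 by rewrite ltr_wpDl ?addr_ge0.
have r0 : 0 < r by rewrite !divr_gt0.
exists r => // u v w ur vr; rewrite mul1r => h.
have -> : W - w = - (w - (W + k * u + l * v)) - (k * u + l * v) by ring.
apply: le_lt_trans (ler_normB _ _) _; rewrite normrN.
apply: (@le_lt_trans _ _ ((`|k| + `|l| + 2) * r)); last first.
  by rewrite /r; rewrite mulrA mulrCA divff ?gt_eqF// mulr1; lra.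
have := ler_normD (k * u) (l * v); rewrite !normrM.
have : `|k| * `|u| <= `|k| * r by rewrite ler_wpM2l// ltW.
have : `|l| * `|v| <= `|l| * r by rewrite ler_wpM2l// ltW.
by lra.
Qed.

Lemma holo_continuous x y e : lft s <= x <= rgt s -> bot s <= y <= top s ->
  0 < e -> exists2 d, 0 < d & forall x' y', lft s <= x' <= rgt s ->
    bot s <= y' <= top s -> `|x' - x| < d -> `|y' - y| < d ->
    `|U x y - U x' y'| < e /\ `|V x y - V x' y'| < e.
Proof.
move=> xs ys e0; have [p [q /(_ 1 ltr01)[d d0 h]]] := holo xs ys.
have [r1 r10 h1] := linear_approx_small (U x y) p (- q) e0.
have [r2 r20 h2] := linear_approx_small (V x y) q p e0.
exists (Num.min d (Num.min r1 r2)); first by rewrite !lt_min d0 r10.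
move=> x' y' xs' ys'; rewrite !lt_min => /and3P[xd x1 x2] /and3P[yd y1 y2].
have [hU hV] := h _ _ xs' ys' xd yd; split.
- by apply: h1 x1 y1 _; rewrite mulNr.
- exact: h2 x2 y2 _.
Qed.

Lemma holo_continuous_line x y : lft s <= x <= rgt s -> bot s <= y <= top s ->
  {within `[bot s, top s], continuous (U x)} /\
  {within `[lft s, rgt s], continuous (V ^~ y)}.
Proof.
move=> xs ys; split; apply/subspace_continuousP => z;
  rewrite /= in_itv /= => zs.
- apply/cvgrPdist_lt => e e0; have [d d0 h] := holo_continuous xs zs e0.
  near=> t; have [] // := h x t xs _ _ _.
  + by near: t; exists 1 => //= t _; rewrite in_itv.
  + by rewrite subrr normr0.
  + rewrite distrC; near: t; exists d => //= t td _; exact: td.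
- apply/cvgrPdist_lt => e e0; have [d d0 h] := holo_continuous zs ys e0.
  near=> t; have [] // := h t y _ ys _ _.
  + by near: t; exists 1 => //= t _; rewrite in_itv.
  + rewrite distrC; near: t; exists d => //= t td _; exact: td.
  + by rewrite subrr normr0.
Unshelve. all: by end_near. Qed.

(** This is the imaginary part of the vanishing of the integral of [(U + iV) dz] along the boundary.
    The real part is the same statement for [i (U + iV)]. *)
Lemma goursat : lft s <= rgt s -> bot s <= top s ->
  itg (fun y => U (rgt s) y - U (lft s) y) (bot s) (top s) =
  itg (fun x => V x (top s) - V x (bot s)) (lft s) (rgt s).
Proof.
move=> lr bt.
pose m (r : rect R) :=
  itg (fun y => U (rgt r) y - U (lft r) y) (bot r) (top r) -
  itg (fun x => V x (top r) - V x (bot r)) (lft r) (rgt r).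
have cU r x : subrect r s -> lft r <= x <= rgt r ->
    {within `[bot r, top r], continuous (U x)}.
  move=> [[? ? ?] [b1 b2 b3]] /andP[? ?].
  apply: continuous_subspaceW (proj1 (@holo_continuous_line x (bot s) _ _)).
  - by apply: subset_itv; rewrite bnd_simp.
  - by apply/andP; split; lra.
  - by rewrite lexx.
have cV r y : subrect r s -> bot r <= y <= top r ->
    {within `[lft r, rgt r], continuous (V ^~ y)}.
  move=> [[b1 b2 b3] [? ? ?]] /andP[? ?].
  apply: continuous_subspaceW (proj2 (@holo_continuous_line (lft s) y _ _)).
  - by apply: subset_itv; rewrite bnd_simp.
  - by rewrite lexx.
  - by apply/andP; split; lra.
have mE r : subrect r s ->
    m r = itg (U (rgt r)) (bot r) (top r) - itg (U (lft r)) (bot r) (top r) -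
      (itg (V ^~ (top r)) (lft r) (rgt r) - itg (V ^~ (bot r)) (lft r) (rgt r)).
  move=> rs; have [[_ lr' _] [_ bt' _]] := rs.
  have rr : lft r <= rgt r <= rgt r by rewrite lr' lexx.
  have ll : lft r <= lft r <= rgt r by rewrite lr' lexx.
  have tt : bot r <= top r <= top r by rewrite bt' lexx.
  have bb : bot r <= bot r <= top r by rewrite bt' lexx.
  by rewrite /m (itgB (cU _ _ rs rr) (cU _ _ rs ll)) (itgB (cV _ _ rs tt) (cV _
    _ rs bb)).
apply/eqP; rewrite -subr_eq0; apply/eqP.
apply: (@additive_rect_eq0 R s m).
- move=> r rs; have [[_ lr' _] [_ bt' _]] := rs.
  have rr : lft r <= rgt r <= rgt r by rewrite lr' lexx.
  have ll : lft r <= lft r <= rgt r by rewrite lr' lexx.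
  have tt : bot r <= top r <= top r by rewrite bt' lexx.
  have bb : bot r <= bot r <= top r by rewrite bt' lexx.
  have lm : lft r <= (lft r + rgt r) / 2 <= rgt r by apply/andP; split; lra.
  have bm : bot r <= (bot r + top r) / 2 <= top r by apply/andP; split; lra.
  rewrite (mE _ rs) !(mE _ (subrect_quadrant _ _ rs)) /quadrant /=.
  rewrite (itg_split (cU r _ rs rr) bm) (itg_split (cU r _ rs ll) bm).
  rewrite (itg_split (cV r _ rs tt) lm) (itg_split (cV r _ rs bb) lm).
  by ring.
- by split; split.
- move=> x y e xs ys e0; have [p [q h]] := holo xs ys.
  have e40 : 0 < e / 4 by rewrite divr_gt0.
  have [d d0 {}h] := h _ e40.
  exists d => // r rs /andP[xr1 xr2] /andP[yr1 yr2];
    set L := rgt r - lft r + (top r - bot r) => Ld.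
  have [[lr1 lr2 lr3] [bt1 bt2 bt3]] := rs.
  have near x' y' : lft r <= x' <= rgt r -> bot r <= y' <= top r ->
    `|U x' y' - (U x y + p * (x' - x) - q * (y' - y))| <= e / 4 * L /\
    `|V x' y' - (V x y + q * (x' - x) + p * (y' - y))| <= e / 4 * L.
    move=> /andP[? ?] /andP[? ?].
    have xL : `|x' - x| <= rgt r - lft r by rewrite ler_norml opprB !lerB.
    have yL : `|y' - y| <= top r - bot r by rewrite ler_norml opprB !lerB.
    have [||||h1 h2] := h x' y'.
    - by rewrite (le_trans lr1)// (le_trans _ lr3).
    - by rewrite (le_trans bt1)// (le_trans _ bt3).
    - by apply: le_lt_trans Ld; rewrite (le_trans xL)// lerDl subr_ge0.
    - by apply: le_lt_trans Ld; rewrite (le_trans yL)// lerDr subr_ge0.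
    have eL : e / 4 * (`|x' - x| + `|y' - y|) <= e / 4 * L.
      by rewrite ler_wpM2l ?(ltW e40)// /L lerD.
    by split; apply: le_trans eL.
  have rr : lft r <= rgt r <= rgt r by rewrite lr2 lexx.
  have ll : lft r <= lft r <= rgt r by rewrite lr2 lexx.
  have tt : bot r <= top r <= top r by rewrite bt2 lexx.
  have bb : bot r <= bot r <= top r by rewrite bt2 lexx.
  (* By the Cauchy-Riemann equations the same [p] governs [U] horizontally and [V] vertically. Both
     integrals are therefore close to [p] times the area of [r], and these main terms cancel in
     [m r]. *)
  have iU : `|itg (fun y => U (rgt r) y - U (lft r) y) (bot r) (top r) -
      p * (rgt r - lft r) * (top r - bot r)| <= e / 2 * L * (top r - bot r).
    apply: itg_approx => //.
      by move=> z; apply: continuousB; [exact: (cU r)|exact: (cU r)].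
    move=> t tr; have [+ _] := near _ _ rr tr; have [+ _] := near _ _ ll tr.
    move=> hl hr; have -> : e / 2 * L = e / 4 * L + e / 4 * L by field.
    apply: le_trans (lerD hr hl); apply: le_trans (ler_normB _ _).
    by rewrite le_eqVlt; apply/orP; left; apply/eqP; congr `|_|; ring.
  have iV : `|itg (fun x => V x (top r) - V x (bot r)) (lft r) (rgt r) -
      p * (top r - bot r) * (rgt r - lft r)| <= e / 2 * L * (rgt r - lft r).
    apply: itg_approx => //.
      by move=> z; apply: continuousB; [exact: (cV r)|exact: (cV r)].
    move=> t tr; have [_ +] := near _ _ tr tt; have [_ +] := near _ _ tr bb.
    move=> hl hr; have -> : e / 2 * L = e / 4 * L + e / 4 * L by field.
    apply: le_trans (lerD hr hl); apply: le_trans (ler_normB _ _).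
    by rewrite le_eqVlt; apply/orP; left; apply/eqP; congr `|_|; ring.
  have := ler_normB (itg (fun y => U (rgt r) y - U (lft r) y) (bot r) (top r) -
      p * (rgt r - lft r) * (top r - bot r)) (itg (fun x => V x (top r) - V x
        (bot r)) (lft r) (rgt r) -
      p * (top r - bot r) * (rgt r - lft r)).
  have -> : forall u v : R, u - p * (rgt r - lft r) * (top r - bot r) - (v -
      p * (top r - bot r) * (rgt r - lft r)) = u - v by move=> u v; ring.
  rewrite -/(m r) => mr.
  have L0 : 0 <= L by rewrite /L; lra.
  have -> : e * L ^+ 2 = e * L * L by ring.
  have : e * L * L = e * L * (rgt r - lft r) + e * L * (top r - bot r) by
    rewrite /L; ring.
  have : 0 <= e * L * (rgt r - lft r) by rewrite !mulr_ge0//; lra.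
  have : 0 <= e * L * (top r - bot r) by rewrite !mulr_ge0//; lra.
  by lra.
Qed.
End Goursat.

(** * Analytic functions on the half-plane *)

Section Complex.
Variable R : realType.
Local Notation normc := (@Normc.normc R).
Local Notation Re := complex.Re.
Local Notation Im := complex.Im.
Implicit Types z w : R[i].

Lemma norm_normc z : `|z| = (normc z)%:C.
Proof. by []. Qed.

Lemma normc_ge0 z : 0 <= normc z.
Proof. by rewrite -ler0c -norm_normc. Qed.

Lemma normcX z n : normc (z ^+ n) = normc z ^+ n.
Proof. by elim: n => [|n IH]; rewrite ?expr0 ?Normc.normc1// !exprS
  Normc.normcM IH. Qed.

Lemma normc_le0 z : normc z <= 0 -> z = 0.
Proof.
by move=> z0; apply: Normc.eq0_normc; apply/eqP; rewrite eq_le z0 normc_ge0.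
Qed.

Lemma normc_real (x : R) : normc x%:C = `|x|.
Proof. by rewrite /= expr0n addr0 sqrtr_sqr. Qed.

Lemma le_Re_normc z : `|Re z| <= normc z.
Proof. by rewrite -lecR -norm_normc normc_ge_Re. Qed.

Lemma le_Im_normc z : `|Im z| <= normc z.
Proof.
case: z => x y; rewrite -sqrtr_sqr /= ler_sqrt ?addr_ge0 ?sqr_ge0//.
by rewrite lerDr sqr_ge0.
Qed.

Lemma normc_leD z : normc z <= `|Re z| + `|Im z|.
Proof.
case: z => x y /=; rewrite -[X in _ <= X]ger0_norm ?addr_ge0// -sqrtr_sqr.
rewrite ler_sqrt ?sqr_ge0// sqrrD !real_normK ?num_real// [X in _ <= X]addrAC
  lerDl.
by rewrite mulrn_wge0// mulr_ge0.
Qed.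

Lemma normc_sqr z : normc z ^+ 2 = Re z ^+ 2 + Im z ^+ 2.
Proof. by case: z => x y /=; rewrite sqr_sqrtr// addr_ge0// sqr_ge0. Qed.

Lemma cvg_complexP (f : nat -> R[i]) (l : R[i]) :
  (f : nat -> R[i]^o) @ \oo --> (l : R[i]^o) <->
  forall e : R, 0 < e -> exists N, forall n, (N <= n)%N -> normc (l - f n) < e.
Proof.
split=> [/cvgrPdist_lt fl e e0|fl].
  have e0' : 0 < e%:C :> R[i] by rewrite ltcR.
  have [N _ NP] := fl _ e0'; exists N => n /NP /=.
  by rewrite ltcR.
(* In the order of [R[i]], [0 < e] forces [e] to be real, so real radii suffice. *)
apply/cvgrPdist_lt => e; rewrite ltcE => /andP[/eqP ie0 e0].
have [N NP] := fl _ e0; exists N => // n /= /NP.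
by rewrite ltcE /= ie0 eqxx.
Qed.

Lemma geometric_tail_le (q : R) n N : 0 <= q -> q <= 1 / 2 ->
  \sum_(n <= i < N) q ^+ i <= 2 * q ^+ n.
Proof.
move=> q0 q12; case: (leqP N n) => nN.
  by rewrite big_geq// mulr_ge0 ?exprn_ge0.
rewrite -[n in \sum_(n <= _ < _) _]add0n big_addn.
have -> : \sum_(0 <= i < N - n) q ^+ (i + n) =
  q ^+ n * \sum_(0 <= i < N - n) q ^+ i.
  by rewrite big_distrr /=; apply: eq_bigr => i _; rewrite exprD mulrC.
rewrite mulrC ler_wpM2r ?exprn_ge0//.
elim: (N - n)%N => [|k IH]; first by rewrite big_geq.
rewrite big_nat_recl// expr0; under eq_bigr do rewrite exprS.
rewrite -big_distrr /=.
have : q * \sum_(0 <= i < k) q ^+ i <= q * 2 by rewrite ler_wpM2l.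
by lra.
Qed.

(** Convergence at the single point [z + t] bounds all [|a n| t ^+ n] by some [M]. For [|u| < t / 2]
    the terms of degree at least 2 are then dominated by a geometric series of ratio
    [|u| / t <= 1 / 2], whose tail is at most [2 M (|u| / t) ^+ 2]. *)
Lemma analytic_expand (h : hfun R) (z : halfplane R) : analytic h ->
  exists b C r, 0 < r /\ forall w : halfplane R, normc (sval w - sval z) < r ->
    normc (h w - (h z + b * (sval w - sval z)))
      <= C * normc (sval w - sval z) ^+ 2.
Proof.
move=> /(_ z) [a [r [r0 hr]]].
have hzE : h z = a 0%N.
  have := hr z; rewrite subrr normr0 ltcR => /(_ r0) /cvg_complexP H.
  apply/eqP; rewrite -subr_eq0; apply/eqP/normc_le0/ler_addgt0Pr => e e0.
  have [N /(_ N.+1 (leqnSn _))] := H e e0; rewrite add0r => /ltW;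
    congr (normc _ <= _).
  rewrite seriesEnat /= big_nat_recl// expr0 mulr1 big1 ?addr0// => i _.
  by rewrite exprS mul0r mulr0.
pose t := r / 2; have t0 : 0 < t by rewrite divr_gt0.
(* Moving to the right by a real [t] cannot leave the half-plane, so the series may be evaluated
   there. *)
have ztP : 0 < Re (sval z + t%:C).
  by case: (z) => -[x y] /= x0; rewrite addr_gt0.
pose zt : halfplane R := exist _ (sval z + t%:C) ztP.
have ztz : sval zt - sval z = t%:C by rewrite /= addrC addKr.
have [M M0 MP] : exists2 M, 0 < M & forall n, normc (a n) * t ^+ n <= M.
  have := hr zt; rewrite ztz [X in X < _]norm_normc ltcR normc_real gtr0_norm//.
  have tr : t < r by rewrite /t; lra.
  move=> /(_ tr) /cvg_complexP H; have [N NP] := H 1 ltr01.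
  pose T n := normc (a n) * t ^+ n.
  have T0 n : 0 <= T n by rewrite mulr_ge0 ?normc_ge0 ?exprn_ge0// ltW.
  (* Two consecutive partial sums within 1 of the limit differ by at most 2. The finitely many
     earlier terms are absorbed into [M] through their sum. *)
  have Tbig n : (N <= n)%N -> T n <= 2.
    move=> Nn; have h1 := NP _ Nn; have h2 := NP n.+1 (leqW Nn).
    have -> : T n = normc (series (fun n => a n * t%:C ^+ n : R[i]^o) n.+1 -
      series (fun n => a n * t%:C ^+ n : R[i]^o) n).
      rewrite !seriesEnat /= big_nat_recr//= [X in normc X]addrC addKr
        Normc.normcM normcX normc_real gtr0_norm//.
    set S1 := series _ _ in h2 *; set S0 := series _ _ in h1 *.
    have -> : S1 - S0 = (h zt - S0) - (h zt - S1) by ring.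
    by apply: le_trans (le_normcD _ _) _; rewrite normcN; lra.
  exists (2 + \sum_(0 <= i < N) T i); first by rewrite ltr_pwDl// sumr_ge0.
  move=> n; have S0 m : 0 <= \sum_(0 <= i < m) T i by rewrite sumr_ge0.
  case: (leqP N n) => [/Tbig|nN]; first by have := S0 N; rewrite /T; lra.
  rewrite -/(T n) (big_cat_nat _ (n := n.+1))//= big_nat_recr//=.
  have := S0 n; have : 0 <= \sum_(n.+1 <= i < N) T i by rewrite sumr_ge0.
  by lra.
exists (a 1%N), (2 * M / t ^+ 2), (t / 2); split; first by rewrite divr_gt0.
move=> w wz; set u := sval w - sval z in wz *.
have wr : `|u| < r%:C by rewrite norm_normc ltcR; rewrite /t in wz; lra.
have /cvg_complexP H := hr w wr.
apply/ler_addgt0Pr => e e0; have [N NP] := H e e0.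
have {NP} := NP (maxn N 2) (leq_maxl _ _).
set S := series _ _ => hS.
have -> : h w - (h z + a 1%N * u) = (h w - S) + (S - (h z + a 1%N * u)) by ring.
apply: le_trans (le_normcD _ _) _; rewrite addrC lerD ?(ltW hS)//.
rewrite /S seriesEnat /= (big_cat_nat _ (n := 2))//= ?leq_maxr//.
rewrite big_nat_recl// big_nat1 expr0 mulr1 expr1 -hzE [X in normc X]addrAC
  subrr add0r.
apply: (@le_trans _ _ (\sum_(2 <= i < maxn N 2) normc (a i * u ^+ i))).
  elim/big_ind2 : _ => [|x1 x2 y1 y2 h1 h2|//]; first by rewrite Normc.normc0.
  by apply: le_trans (le_normcD _ _) _; exact: lerD.
pose q := normc u / t.
have q0 : 0 <= q by rewrite divr_ge0 ?normc_ge0// ltW.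
have q12 : q <= 1 / 2 by rewrite ler_pdivrMr//; lra.
apply: (@le_trans _ _ (\sum_(2 <= i < maxn N 2) M * q ^+ i)).
  apply: ler_sum => i _; rewrite Normc.normcM normcX.
  have -> : normc (a i) * normc u ^+ i = (normc (a i) * t ^+ i) * q ^+ i.
    by rewrite -mulrA -exprMn /q mulrCA divff ?mulr1// gt_eqF.
  by rewrite ler_wpM2r// exprn_ge0.
rewrite -big_distrr /=.
apply: le_trans (_ : M * (2 * q ^+ 2) <= _).
  by rewrite ler_wpM2l ?(ltW M0)// geometric_tail_le.
rewrite le_eqVlt; apply/orP; left; apply/eqP; rewrite /q.
by field; rewrite gt_eqF.
Qed.

End Complex.

(** * Binomial series, kernels and stability of analyticity *)

Section AnalyticClosure.
Variable R : realType.
Local Notation normc := (@Normc.normc R).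
Local Notation Re := complex.Re.
Local Notation Im := complex.Im.

(** Partial sums of the binomial series of [(1 - v)^-(m+1)]. *)
Definition negbin_sum (m : nat) (v : R[i]) (N : nat) : R[i] :=
  \sum_(0 <= n < N) 'C(n + m, m)%:R * v ^+ n.

Lemma negbin_sum0 v N : (1 - v) * negbin_sum 0 v N = 1 - v ^+ N.
Proof.
elim: N => [|N IH]; rewrite /negbin_sum; first by rewrite big_geq// expr0 mulr0
  subrr.
rewrite big_nat_recr//= mulrDr IH addn0 bin0 mul1r exprS; ring.
Qed.

(** Pascal's rule telescopes the product with [1 - v]. The boundary term left over tends to 0 for
    small [v], which gives the limit by induction on [m]. *)
Lemma negbin_sumS m v N : (1 - v) * negbin_sum m.+1 v N =
  negbin_sum m v N - 'C(N + m, m.+1)%:R * v ^+ N.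
Proof.
rewrite /negbin_sum; elim: N => [|N IH].
  by rewrite !big_geq// add0n bin_small// mul0r mulr0 subrr.
rewrite !big_nat_recr//= mulrDr IH addnS addSn binS natrD exprS mulrDl; ring.
Qed.

Lemma leq_bin_exp2 n k : ('C(n, k) <= 2 ^ n)%N.
Proof.
elim: n k => [|n IH] [|k] //; first by rewrite bin0 expn_gt0.
by rewrite binS expnS mul2n -addnn leq_add.
Qed.

(** The radius [1 / 4] beats the crude bound [2 ^ (N + m)] on the binomial coefficient, leaving
    [2 ^+ m / 2 ^+ N]. *)
Lemma cvg_negbin_tail m v : normc v <= 1 / 4 ->
  (fun N => 'C(N + m, m.+1)%:R * v ^+ N : R[i]^o) @ \oo --> (0 : R[i]^o).
Proof.
move=> v4; apply/cvg_complexP => e e0.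
exists (Num.bound (2 ^+ m / e)) => n nN.
rewrite sub0r normcN Normc.normcM normcX.
have -> : normc ('C(n + m, m.+1)%:R : R[i]) = 'C(n + m, m.+1)%:R.
  by rewrite -(rmorph_nat (real_complex R)) normc_real ger0_norm.
have bin_le : ('C(n + m, m.+1)%:R : R) <= 2 ^+ n * 2 ^+ m.
  by rewrite -exprD -natrX ler_nat; exact: leq_bin_exp2.
apply: (@le_lt_trans _ _ (2 ^+ n * 2 ^+ m * (1 / 4) ^+ n)).
  by rewrite ler_pM// ?exprn_ge0 ?normc_ge0// lerXn2r ?nnegrE ?normc_ge0.
rewrite mulrAC -exprMn.
have -> : 2 * (1 / 4) = 2^-1 :> R by field.
rewrite exprVn mulrC ltr_pdivrMr ?exprn_gt0// mulrC -ltr_pdivrMr//.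
apply: lt_le_trans (archi_boundP _) _; first by rewrite divr_ge0 ?exprn_ge0//
  ltW.
apply: (@le_trans _ _ n%:R); first by rewrite ler_nat.
by rewrite -natrX ler_nat ltnW// ltn_expl.
Qed.

Lemma cvg_negbin m v : normc v <= 1 / 4 ->
  (negbin_sum m v : nat -> R[i]^o) @ \oo --> ((1 - v)^-1 ^+ m.+1 : R[i]^o).
Proof.
move=> v4.
have v1 : 1 - v != 0.
  rewrite subr_eq0; apply/eqP => v1; move: v4; rewrite -v1 Normc.normc1; lra.
elim: m => [|m IH].
  have -> : negbin_sum 0 v = (fun N => (1 - v)^-1 * (1 - v ^+ N)).
    by apply/funext => N; rewrite -negbin_sum0 mulKf.
  rewrite expr1.
  suff : (fun N => (1 - v)^-1 * (1 - v ^+ N) : R[i]^o) @ \oo -->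
         ((1 - v)^-1 * (1 - 0) : R[i]^o) by rewrite subr0 mulr1.
  apply: cvgM; first exact: cvg_cst.
  apply: cvgB; first exact: cvg_cst.
  apply/cvg_complexP => e e0; exists (Num.bound e^-1) => n nN.
  rewrite sub0r normcN normcX.
  apply: (@le_lt_trans _ _ ((1 / 2) ^+ n)).
    by rewrite lerXn2r ?nnegrE ?normc_ge0//; lra.
  rewrite div1r exprVn -[X in _ < X]invrK ltf_pV2 ?posrE ?invr_gt0 ?exprn_gt0//.
  apply: lt_le_trans (archi_boundP _) _; first by rewrite invr_ge0 ltW.
  apply: (@le_trans _ _ n%:R); first by rewrite ler_nat.
  by rewrite -natrX ler_nat ltnW// ltn_expl.
have -> : negbin_sum m.+1 v =
    (fun N => (1 - v)^-1 * (negbin_sum m v N - 'C(N + m, m.+1)%:R * v ^+ N)).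
  by apply/funext => N; rewrite -negbin_sumS mulKf.
suff : (fun N => (1 - v)^-1 * (negbin_sum m v N - 'C(N + m,
  m.+1)%:R * v ^+ N) : R[i]^o)
    @ \oo --> ((1 - v)^-1 * ((1 - v)^-1 ^+ m.+1 - 0) : R[i]^o) by rewrite subr0
      -exprS.
apply: cvgM; first exact: cvg_cst.
by apply: cvgB; [exact: IH|exact: cvg_negbin_tail].
Qed.

(** For [m = l.+1] the exponent is [l + 2], and for [Re s > 0] this is, up to a constant, the
    reproducing kernel of the Bergman space at the point conjugate to [s]. *)
Definition kernel (s : R[i]) (m : nat) : hfun R :=
  fun z => (sval z + s)^-1 ^+ m.+1.

Lemma halfplane_add_neq0 (z : halfplane R) (s : R[i]) : 0 <= Re s ->
  sval z + s != 0.
Proof.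
case: z s => -[x y] /= x0 [s t] /= s0; rewrite eq_complex /= negb_and.
by rewrite gt_eqF// ltr_wpDr.
Qed.

(** With [d = z + s] and [u = w - z], one has [w + s = d (1 - v)] for [v = - u / d], so the binomial
    series in [v] gives the expansion. The radius [|d| / 4] ensures [|v| <= 1 / 4]. *)
Lemma analytic_kernel s m : 0 <= Re s -> analytic (kernel s m).
Proof.
move=> s0 z; have d0 := halfplane_add_neq0 z s0; set d := sval z + s in d0.
have nd0 : 0 < normc d by rewrite lt_neqAle normc_ge0 andbT eq_sym;
  apply: contra d0 => /eqP/Normc.eq0_normc ->.
exists (fun n => 'C(n + m, m)%:R * (- d^-1) ^+ n * d^-1 ^+ m.+1), (normc d / 4).
split=> [|w]; first by rewrite divr_gt0.
rewrite norm_normc ltcR; set u := sval w - sval z => ud.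
have v4 : normc (- d^-1 * u) <= 1 / 4.
  rewrite Normc.normcM normcN Normc.normcV mulrC ler_pdivrMr//; lra.
have -> : kernel s m w = (1 - (- d^-1 * u))^-1 ^+ m.+1 * d^-1 ^+ m.+1.
  rewrite -exprMn -invfM; congr (_^-1 ^+ _).
  by rewrite /u /d; field.
have -> : series (fun n => 'C(n + m, m)%:R * (- d^-1) ^+ n * d^-1 ^+ m.+1 * u
  ^+ n : R[i]^o) =
   (fun N => negbin_sum m (- d^-1 * u) N * d^-1 ^+ m.+1).
  apply/funext => N; rewrite seriesEnat /= /negbin_sum big_distrl /=.
  by apply: eq_bigr => i _; rewrite exprMn; ring.
by apply: cvgM; [exact: cvg_negbin|exact: cvg_cst].
Qed.

Lemma analyticZ (c : R[i]) (h : hfun R) : analytic h -> analytic (c *: h).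
Proof.
move=> ah z; have [a [r [r0 hr]]] := ah z.
exists (fun n => c * a n), r; split; first exact: r0.
move=> w /hr hw.
have -> : series (fun n => c * a n * (sval w - sval z) ^+ n : R[i]^o) =
   (fun N => c * series (fun n => a n * (sval w - sval z) ^+ n : R[i]^o) N).
  apply/funext => N; rewrite !seriesEnat /= big_distrr /=.
  by apply: eq_bigr => i _; rewrite mulrA.
by apply: cvgM; [exact: cvg_cst|exact: hw].
Qed.

Lemma analytic_comp_affine (h : hfun R) (g : halfplane R -> halfplane R) (c : R)
    (b : R[i]) : 0 < c -> (forall w, sval (g w) = c%:C * sval w + b) ->
  analytic h -> analytic (h \o g).
Proof.
move=> c0 gE ah z; have [a [r [r0 hr]]] := ah (g z).
exists (fun n => a n * c%:C ^+ n), (r / c); split=> [|w];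
  first by rewrite divr_gt0.
have gu : sval (g w) - sval (g z) = c%:C * (sval w - sval z) by rewrite !gE;
  ring.
rewrite norm_normc ltcR ltr_pdivlMr// => wz.
have gwz : `|sval (g w) - sval (g z)| < r%:C.
  by rewrite gu norm_normc ltcR Normc.normcM normc_real gtr0_norm// mulrC.
have -> : series (fun n => a n * c%:C ^+ n * (sval w - sval z) ^+ n : R[i]^o) =
    series (fun n => a n * (sval (g w) - sval (g z)) ^+ n : R[i]^o).
  apply/funext => N; rewrite !seriesEnat /=.
  by apply: eq_bigr => i _; rewrite gu exprMn mulrA.
exact: hr (g w) gwz.
Qed.
End AnalyticClosure.

(** * Square-integrable functions *)

Section PlaneMeasurability.
Variable R : realType.
Local Notation plane := (measurableTypeR R * measurableTypeR R)%type.

Definition box_near (p : plane) (d : R) (q : plane) : Prop :=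
  `|q.1 - p.1 : R| < d /\ `|q.2 - p.2 : R| < d.

(** An open set is the union of the boxes with rational corners that it contains, and there are
    countably many of them. *)
Lemma measurable_box_open (A : set plane) :
  (forall p, A p -> exists2 d, 0 < d & forall q, box_near p d q -> A q) ->
  measurable A.
Proof.
move=> oA.
pose B (i : rat * rat * rat * rat) : set plane :=
  `]ratr i.1.1.1 : R, ratr i.1.1.2 : R[%classic `*`
  `]ratr i.1.2 : R, ratr i.2 : R[%classic.
have mB i : measurable (B i) by exact: measurableX.
have -> : A = \bigcup_i (if `[< B i `<=` A >] then B i else set0).
  apply/seteqP; split=> [p Ap|p [i _]]; last by case: asboolP => // /(_ p).
  have [d d0 dA] := oA p Ap.
  have ep (x : R) : x - d < x /\ x < x + d by split; lra.
  have [q1] := rat_in_itvoo (ep p.1).1; rewrite in_itv /= => /andP[q1a q1b].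
  have [q2] := rat_in_itvoo (ep p.1).2; rewrite in_itv /= => /andP[q2a q2b].
  have [q3] := rat_in_itvoo (ep p.2).1; rewrite in_itv /= => /andP[q3a q3b].
  have [q4] := rat_in_itvoo (ep p.2).2; rewrite in_itv /= => /andP[q4a q4b].
  exists (q1, q2, q3, q4) => //; case: asboolP => [_|[]].
    by split; rewrite /= in_itv /=; apply/andP.
  move=> q [/= ]; rewrite !in_itv /= => /andP[? ?] /andP[? ?]; apply: dA.
  by split; rewrite ltr_norml; apply/andP; split; lra.
apply: countable_bigcupT_measurable => // i.
by case: asboolP.
Qed.

(** The first hypothesis says both that [D] is open and that [f] is continuous on it. No continuity
    is asked across the boundary, where [at_xy] may jump to its junk value 0. *)
Lemma measurable_box_continuous (D : set plane) (f : plane -> R) :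
  (forall p e, D p -> 0 < e -> exists2 d, 0 < d &
     forall q, box_near p d q -> D q /\ `|f p - f q| < e) ->
  (forall p, ~ D p -> f p = 0) ->
  measurable_fun setT f.
Proof.
move=> cf f0.
have mD : measurable D.
  apply: measurable_box_open => p Dp; have [d d0 h] := cf p 1 Dp ltr01.
  by exists d => // q /h[].
have -> : f = f \_ D.
  apply/funext => p; rewrite patchE; case: ifPn => //; rewrite notin_setE;
    exact: f0.
apply/(measurable_restrictT _ mD) => _.
apply: (measurability _ (RGenOInfty.measurableE R)) => //.
move=> /= _ [_ [a ->] <-]; apply: measurable_box_open => p [Dp].
rewrite /= in_itv /= andbT => afp.
have fpa : 0 < f p - a by rewrite subr_gt0.
have [d d0 h] := cf p _ Dp fpa.
exists d => // q /h[Dq]; rewrite ltr_norml => /andP[_ fpq]; split=> //=.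
by rewrite in_itv /= andbT; lra.
Qed.

End PlaneMeasurability.

Section Bergman.
Variables (R : realType) (l : nat).
Local Notation plane := (measurableTypeR R * measurableTypeR R)%type.
Local Notation normc := (@Normc.normc R).
Local Notation Re := complex.Re.
Local Notation Im := complex.Im.
Implicit Types (f : plane -> R) (h : hfun R).

Definition halfpt (x y : R) (x0 : 0 < x) : halfplane R := exist _ (x +i* y) x0.

Lemma at_xyE h (p : plane) (x0 : 0 < (p.1 : R)) : at_xy h p = h (halfpt p.2 x0).
Proof.
rewrite /at_xy; case: insubP => [w _ wE|/negP/(_ x0)//].
by congr h; apply: val_inj.
Qed.

Lemma at_xy_sval h (w : halfplane R) : at_xy h (Re (sval w), Im (sval w)) = h w.
Proof.
rewrite /at_xy; case: insubP => [w' _ wE|/negP[]]; last by case: (w) => -[x y].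
by congr h; apply: val_inj; rewrite /= wE; case: (w) => -[x y].
Qed.

Lemma at_xy0 h (p : plane) : (p.1 : R) <= 0 -> at_xy h p = 0.
Proof. by move=> p0; rewrite /at_xy insubF//= ltNge p0. Qed.

Lemma analytic_near h (w : halfplane R) (e : R) : analytic h -> 0 < e ->
  exists2 d, 0 < d & forall w' : halfplane R,
    normc (sval w' - sval w) < d -> normc (h w' - h w) < e.
Proof.
move=> ah e0; have [b [C [r [r0 H]]]] := analytic_expand w ah.
pose K := `|C| * r + normc b + 1.
have K0 : 0 < K by rewrite ltr_wpDl// addr_ge0 ?normc_ge0// mulr_ge0// ltW.
exists (Num.min r (e / K)); first by rewrite lt_min r0 divr_gt0.
move=> w'; rewrite lt_min => /andP[wr we]; set u := sval w' - sval w in wr we *.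
have -> : h w' - h w = (h w' - (h w + b * u)) + b * u by ring.
apply: le_lt_trans (le_normcD _ _) _; have := H w' wr; rewrite Normc.normcM -/u.
have n0 := normc_ge0 u; set n := normc u in wr we n0 *.
have : C * n ^+ 2 <= `|C| * r * n.
  apply: (@le_trans _ _ (`|C| * n ^+ 2));
    first by rewrite ler_wpM2r ?sqr_ge0// ler_norm.
  by rewrite expr2 mulrA ler_wpM2r// ler_wpM2l// ltW.
rewrite ltr_pdivlMr// /K in we; lra.
Qed.

Lemma measurable_at_xy h : analytic h ->
  measurable_fun setT (fun p => Re (at_xy h p)) /\
  measurable_fun setT (fun p => Im (at_xy h p)).
Proof.
move=> ah.
have H (p : plane) (e : R) : rhp R p -> 0 < e -> exists2 d, 0 < d &
    forall q : plane, box_near p d q ->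
      rhp R q /\ normc (at_xy h q - at_xy h p) < e.
  rewrite /rhp /= => p0 e0; have [d d0 hd] :=
    analytic_near (halfpt p.2 p0) ah e0.
  exists (Num.min (p.1 : R) (d / 2)); first by rewrite lt_min p0 divr_gt0.
  move=> q [/=]; rewrite !lt_min => /andP[q1 q1d] /andP[_ q2d].
  have q0 : 0 < (q.1 : R) by move: q1; rewrite ltr_norml => /andP[]; lra.
  split=> //; rewrite (at_xyE h p0) (at_xyE h q0); apply: hd.
  by apply: le_lt_trans (normc_leD _) _; rewrite /=; lra.
split; apply: (@measurable_box_continuous R (rhp R)).
- move=> p e p0 e0; have [d d0 dP] := H p e p0 e0; exists d => // q /dP[q0 qe];
    split=> //.
  by rewrite distrC -raddfB; apply: le_lt_trans qe; exact: le_Re_normc.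
- by move=> p /negP; rewrite -leNgt => p0; rewrite at_xy0.
- move=> p e p0 e0; have [d d0 dP] := H p e p0 e0; exists d => // q /dP[q0 qe];
    split=> //.
  by rewrite distrC -raddfB; apply: le_lt_trans qe; exact: le_Im_normc.
- by move=> p /negP; rewrite -leNgt => p0; rewrite at_xy0.
Qed.

(* The weight vanishes off the half-plane, so that all integrals can be taken
   over the whole plane. *)
Definition wt (p : plane) : R := (0 < (p.1 : R))%R%:R * (p.1 : R) ^+ l.

Lemma wt_ge0 p : 0 <= wt p.
Proof. by rewrite /wt; case: ltP => [p0|];
  rewrite ?mul0r// mul1r exprn_ge0// ltW. Qed.

Lemma measurable_wt : measurable_fun setT wt.
Proof.
apply: measurable_funM; last first.
  by apply: measurable_funX; exact: measurable_fst.
rewrite (_ : (fun p : plane => (0 < (p.1 : R))%R%:R) = \1_(rhp R)).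
  apply: measurable_indic.
  apply: measurable_box_open => p p0; exists p.1 => // q [q1 _].
  by move: q1; rewrite ltr_norml /rhp /= => /andP[]; lra.
apply/funext => p; rewrite indicE; suff -> : (p \in rhp R) =
  (0 < (p.1 : R)) by [].
by apply/idP/idP; rewrite inE.
Qed.

Lemma integral_rhp (f : plane -> R) :
  (\int[area R]_(p in rhp R) ((p.1 : R) ^+ l * f p)%:E =
    \int[area R]_p (wt p * f p)%:E)%E.
Proof.
rewrite integral_mkcond; apply: eq_integral => p _; rewrite patchE /wt.
case: ifPn => [|/negP]; rewrite inE /rhp /=; first by move=> ->; rewrite mul1r.
by move=> /negP/negbTE ->; rewrite !mul0r.
Qed.

End Bergman.

Section SquareIntegrable.
Variables (R : realType) (l : nat).
Local Notation plane := (measurableTypeR R * measurableTypeR R)%type.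
Local Notation normc := (@Normc.normc R).
Local Notation Re := complex.Re.
Local Notation Im := complex.Im.
Implicit Types (u v : plane -> R[i]).

Definition cmeasurable d (T : measurableType d) (u : T -> R[i]) :=
  measurable_fun setT (fun p => Re (u p)) /\
  measurable_fun setT (fun p => Im (u p)).

Definition wsqnorm u : \bar R := (\int[area R]_p (wt l p * normc (u p) ^+
  2)%:E)%E.

Definition sqint u := cmeasurable u /\ (wsqnorm u < +oo)%E.

Lemma cmeasurable_normc2 u : cmeasurable u ->
  measurable_fun setT (fun p => normc (u p) ^+ 2).
Proof.
move=> [mR mI]; under eq_fun do rewrite normc_sqr.
by apply: measurable_funD; apply: measurable_funX.
Qed.

Lemma measurable_wtM (f : plane -> R) : measurable_fun setT f ->
  measurable_fun setT (fun p => (wt l p * f p)%:E).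
Proof.
by move=> mf; apply/measurable_EFinP; apply: measurable_funM => //;
  exact: measurable_wt.
Qed.

Lemma wsqnorm_ge0 u : (0 <= wsqnorm u)%E.
Proof. by apply: integral_ge0 => p _; rewrite lee_fin mulr_ge0 ?wt_ge0
  ?sqr_ge0. Qed.

Lemma sqnormE (h : hfun R) : sqnorm l h = ((pi^-1)%:E * wsqnorm (at_xy h))%E.
Proof. by rewrite /sqnorm integral_rhp. Qed.

Lemma sqnorm_lty (h : hfun R) : (sqnorm l h < +oo)%E =
  (wsqnorm (at_xy h) < +oo)%E.
Proof.
rewrite sqnormE; have := wsqnorm_ge0 (at_xy h).
have pi0 : 0 < (pi^-1 : R) by rewrite invr_gt0 pi_gt0.
case: (wsqnorm _) => [r| |]//= _; first by rewrite !ltry.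
by rewrite gt0_muley ?lte_fin.
Qed.

Lemma bergman_sqint (h : hfun R) : bergman l h -> sqint (at_xy h).
Proof. by move=> [/measurable_at_xy ah]; rewrite sqnorm_lty. Qed.

Lemma wt_aff2 (c b e : R) (p : plane) : 0 < c -> 0 <= b ->
  c ^+ l * wt l p <= wt l (aff2 c b e p).
Proof.
move=> c0 b0; have [p0|p0] := ltP 0 (p.1 : R); last first.
  by rewrite [wt l p]/wt ltNge p0 mul0r mulr0; exact: wt_ge0.
have q0 : 0 < c * (p.1 : R) + b by rewrite ltr_wpDr// mulr_gt0.
rewrite /wt /aff2 /aff1 /= p0 q0 !mul1r -exprMn lerXn2r ?nnegrE ?(ltW q0)//.
  by rewrite mulr_ge0// ltW.
by rewrite lerDl.
Qed.

Lemma cmeasurable_aff2 u (c b e : R) : cmeasurable u ->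
  cmeasurable (u \o aff2 c b e).
Proof.
by move=> [mR mI]; split; [apply: (measurableT_comp mR)|apply:
  (measurableT_comp mI)];
  exact: measurable_aff2.
Qed.

(** The Jacobian contributes [c ^+ 2] and the weight [c ^+ l]. Only an inequality holds, because a
    shift to the right by [b >= 0] increases the weight and may leave out part of the half-plane. *)
Lemma wsqnorm_aff2 u (c b e : R) : 0 < c -> 0 <= b -> cmeasurable u ->
  ((c ^+ l.+2)%:E * wsqnorm (u \o aff2 c b e) <= wsqnorm u)%E.
Proof.
move=> c0 b0 mu; have c20 : 0 <= c ^+ 2 by rewrite exprn_ge0// ltW.
have cl0 : 0 <= c ^+ l by rewrite exprn_ge0// ltW.
have w0 p : (0 <= (wt l p * normc (u p) ^+ 2)%:E)%E.
  by rewrite lee_fin mulr_ge0 ?wt_ge0 ?sqr_ge0.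
have m1 := measurable_wtM (cmeasurable_normc2 mu).
have m2 := measurable_wtM (cmeasurable_normc2 (cmeasurable_aff2 c b e mu)).
rewrite [leRHS](ge0_integral_aff2 b e c0 m1 w0).
rewrite -addn2 exprD mulrC EFinM -muleA lee_wpmul2l ?lee_fin//.
rewrite -ge0_integralZl//; last first.
  by move=> p _; rewrite lee_fin mulr_ge0 ?wt_ge0 ?sqr_ge0.
apply: ge0_le_integral => //.
- by move=> p _; rewrite mule_ge0// lee_fin mulr_ge0 ?wt_ge0 ?sqr_ge0.
- exact: measurable_funeM.
- by apply: measurableT_comp m1 _; exact: measurable_aff2.
- move=> p _; rewrite -EFinM lee_fin mulrA ler_wpM2r ?sqr_ge0//.
  exact: wt_aff2.
Qed.

Lemma sqint_aff2 u (c b e : R) : 0 < c -> 0 <= b -> sqint u ->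
  sqint (u \o aff2 c b e).
Proof.
move=> c0 b0 [mu uoo]; split; first exact: cmeasurable_aff2.
have := le_lt_trans (wsqnorm_aff2 e c0 b0 mu) uoo.
have := wsqnorm_ge0 (u \o aff2 c b e); case: (wsqnorm _) => [r| |]//= _.
  by move=> _; rewrite ltry.
by rewrite gt0_muley ?lte_fin ?exprn_gt0.
Qed.

(** Stands in for the Cauchy-Schwarz inequality: the products only have to be integrable, with a
    bound uniform under shifts. *)
Lemma normc_mul_le (x y : R[i]) :
  normc (x * y^*%C) <= normc x ^+ 2 + normc y ^+ 2.
Proof.
have -> : normc (x * y^*%C) = normc x * normc y.
  by rewrite Normc.normcM; congr (_ * _); case: y => y1 y2 /=; rewrite sqrrN.
have := sqr_ge0 (normc x - normc y); have := normc_ge0 x; have := normc_ge0 y.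
by rewrite sqrrB; nra.
Qed.

Lemma integral_wt_normc_mul u v : cmeasurable u -> cmeasurable v ->
  (\int[area R]_p (wt l p * (normc (u p) ^+ 2 + normc (v p) ^+ 2))%:E =
   wsqnorm u + wsqnorm v)%E.
Proof.
move=> mu mv; rewrite -ge0_integralD//.
- by apply: eq_integral => p _; rewrite mulrDr EFinD.
- by move=> p _; rewrite lee_fin mulr_ge0 ?wt_ge0 ?sqr_ge0.
- exact: measurable_wtM (cmeasurable_normc2 mu).
- by move=> p _; rewrite lee_fin mulr_ge0 ?wt_ge0 ?sqr_ge0.
- exact: measurable_wtM (cmeasurable_normc2 mv).
Qed.

Lemma measurable_ReM d (T : measurableType d) (u v : T -> R[i]) :
  cmeasurable u -> cmeasurable v ->
  measurable_fun setT (fun p => Re (u p * (v p)^*%C)).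
Proof.
move=> [uR uI] [vR vI].
rewrite (_ : (fun _ => _) = (fun p => Re (u p) * Re (v p) + Im (u p) * Im (v
  p))).
  by apply: measurable_funD; apply: measurable_funM.
by apply/funext => p; case: (u p) (v p) => [x1 y1] [x2 y2] /=; ring.
Qed.

Lemma measurable_ImM d (T : measurableType d) (u v : T -> R[i]) :
  cmeasurable u -> cmeasurable v ->
  measurable_fun setT (fun p => Im (u p * (v p)^*%C)).
Proof.
move=> [uR uI] [vR vI].
rewrite (_ : (fun _ => _) = (fun p => Im (u p) * Re (v p) - Re (u p) * Im (v
  p))).
  by apply: measurable_funB; apply: measurable_funM.
by apply/funext => p; case: (u p) (v p) => [x1 y1] [x2 y2] /=; ring.
Qed.

Lemma le_integral_wt (f : plane -> R) u v : measurable_fun setT f ->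
  cmeasurable u -> cmeasurable v -> (forall p,
    `|f p| <= normc (u p * (v p)^*%C)) ->
  (\int[area R]_p `| (wt l p * f p)%:E | <= wsqnorm u + wsqnorm v)%E.
Proof.
move=> mf mu mv fuv; rewrite -integral_wt_normc_mul//.
apply: ge0_le_integral => //.
- by have := measurableT_comp (@abse_measurable R setT) (measurable_wtM mf).
- by apply: measurable_wtM; apply: measurable_funD; exact: cmeasurable_normc2.
- move=> p _; rewrite /= lee_fin normrM ger0_norm ?wt_ge0// ler_wpM2l ?wt_ge0//.
  exact: le_trans (fuv p) (normc_mul_le _ _).
Qed.

Lemma integrable_wt (f : plane -> R) u v : measurable_fun setT f ->
  sqint u -> sqint v -> (forall p, `|f p| <= normc (u p * (v p)^*%C)) ->
  (area R).-integrable setT (fun p => (wt l p * f p)%:E).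
Proof.
move=> mf [mu uoo] [mv voo] fuv; apply/integrableP; split;
  first exact: measurable_wtM.
by apply: le_lt_trans (le_integral_wt mf mu mv fuv) _; exact: lte_add_pinfty.
Qed.

Lemma integrable_ReM u v : sqint u -> sqint v ->
  (area R).-integrable setT (fun p => (wt l p * Re (u p * (v p)^*%C))%:E).
Proof.
move=> su sv; apply: (integrable_wt (u := u) (v := v)) => //.
  by apply: measurable_ReM; [case: su|case: sv].
by move=> p; exact: le_Re_normc.
Qed.

Lemma integrable_ImM u v : sqint u -> sqint v ->
  (area R).-integrable setT (fun p => (wt l p * Im (u p * (v p)^*%C))%:E).
Proof.
move=> su sv; apply: (integrable_wt (u := u) (v := v)) => //.
  by apply: measurable_ImM; [case: su|case: sv].
by move=> p; exact: le_Im_normc.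
Qed.

End SquareIntegrable.

(** * Self-adjointness of real translations *)

Section PlaneArea.
Variable R : realType.
Local Notation plane := (measurableTypeR R * measurableTypeR R)%type.
Local Notation leb := (@lebesgue_measure R).

(** The same measure as [area], under a name that carries the sigma-finite structure required by
    Fubini's theorem on the product of the plane and the line. *)
Definition plane_area : set plane -> \bar R := (leb \x leb)%E.

HB.instance Definition _ := Measure.on plane_area.

Lemma sigma_finite_plane_area : sigma_finite setT plane_area.
Proof.
have /sigma_finiteP[F [TF ndF Foo]] := sigma_finiteT leb.
exists (fun n => F n `*` F n).
  rewrite -setXTT; apply/seteqP; split=> [[x y] _|[x y] _ //].
  have := I; rewrite -[True]/([set: measurableTypeR R] x) {1}TF => -[n _ Fx].
  have := I; rewrite -[True]/([set: measurableTypeR R] y) {1}TF => -[k _ Fy].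
  exists (maxn n k) => //; split.
  - by move: x Fx; exact/subsetPset/ndF/leq_maxl.
  - by move: y Fy; exact/subsetPset/ndF/leq_maxr.
move=> n; have [mF Fn] := Foo n; split; first exact: measurableX.
by rewrite /plane_area product_measure1E// lte_mul_pinfty// ge0_fin_numE.
Qed.

HB.instance Definition _ := Measure_isSigmaFinite.Build _ _ _ plane_area
  sigma_finite_plane_area.

End PlaneArea.
Arguments plane_area R : clear implicits.

(** * Exchanging a weighted area integral with an integral over a segment *)

Section FubiniInterval.
Variables (R : realType) (l : nat).
Local Notation plane := (measurableTypeR R * measurableTypeR R)%type.
Local Notation leb := (@lebesgue_measure R).

(** The bound uniform in [t] gives absolute integrability on the product, with [[c, d]] encoded as
    an indicator factor. Integrability in [t] is asked only for [p] in the half-plane, since [wt]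
    vanishes elsewhere. *)
Lemma fubini_itg (Phi : R -> plane -> R) (c d C : R) :
  measurable_fun setT (fun q : (measurableTypeR R * plane)%type => Phi q.1 q.2)
    ->
  (forall t, c <= t <= d -> (\int[area R]_p `| (wt l p * Phi t p)%:E | <=
    C%:E)%E) ->
  (forall p : plane, 0 < (p.1 : R) -> leb.-integrable `[c,
    d] (EFin \o Phi ^~ p)) ->
  (area R).-integrable setT (fun p => (wt l p * itg (Phi ^~ p) c d)%:E) /\
  (\int[area R]_p (wt l p * itg (Phi ^~ p) c d)%:E =
   \int[leb]_(t in `[c, d]) \int[area R]_p (wt l p * Phi t p)%:E)%E.
Proof.
move=> mPhi bPhi iPhi.
pose f (q : (plane * measurableTypeR R)%type) : \bar R :=
  (\1_(`[c, d]%classic : set R) (q.2 : R) * (wt l q.1 * Phi q.2 q.1))%:E.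
have mf : measurable_fun setT f.
  apply/measurable_EFinP; apply: measurable_funM; last first.
    apply: measurable_funM.
      exact: measurableT_comp (measurable_wt l) measurable_fst.
    apply: (measurableT_comp mPhi (g := fun q : (plane * measurableTypeR
      R)%type => (q.2, q.1))).
    by apply: measurable_fun_pair; [exact: measurable_snd|exact:
      measurable_fst].
  have mI : measurable_fun setT (\1_(`[c,
    d]%classic : set R) : measurableTypeR R -> R).
    by apply: measurable_indic.
  exact: measurableT_comp mI measurable_snd.
have intf : (plane_area R \x leb)%E.-integrable setT f.
  have [_ H] := integrable21ltyP (plane_area R) leb mf; apply: H.
  apply: (@le_lt_trans _ _ (\int[leb]_(t in `[c, d]) C%:E)%E); last first.
    rewrite integral_cst//= lebesgue_measure_itv /=.
    by case: ifP => _; rewrite ?mule0 ?ltry// -EFinM ltry.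
  rewrite [leRHS]integral_mkcond; apply: ge0_le_integral => //.
  - by move=> t _; apply: integral_ge0.
  - have mf' : measurable_fun setT (abse \o f) by exact: (measurableT_comp
      (@abse_measurable R setT) mf).
    exact: (measurable_fun_fubini_tonelli_G (m1 :=
      plane_area R) (abse \o f) mf' (fun=> abse_ge0 _)).
  - by apply/(measurable_restrictT _ (measurable_itv _)); exact: measurable_cst.
  - move=> t _; rewrite patchE; case: ifPn => tcd.
      have tcd' := tcd; rewrite inE /= in_itv /= in tcd';
        apply: le_trans (bPhi t tcd').
      rewrite le_eqVlt; apply/orP; left; apply/eqP; apply: eq_integral => p _.
      by rewrite /f /= indicE tcd mul1r.
    rewrite integral0_eq// => p _.
    by rewrite /f /= indicE (negbTE tcd) mul0r normr0.
have FE p : (wt l p * itg (Phi ^~ p) c d)%:E = (\int[leb]_t f (p, t))%E.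
  have [p0|p0] := ltP 0 (p.1 : R); last first.
    have w0 : wt l p = 0 by rewrite /wt ltNge p0 mul0r.
    by rewrite w0 mul0r integral0_eq// => t _; rewrite /f /= w0 mul0r mulr0.
  rewrite /itg /Rintegral EFinM fineK;
    last exact: integrable_fin_num (iPhi p p0).
  rewrite -integralZl//; last exact: iPhi.
  rewrite integral_mkcond; apply: eq_integral => t _;
    rewrite patchE /f /= indicE.
  by case: ifPn => _; rewrite ?mul0r ?mul1r ?EFinM.
have FEf : (fun p => (wt l p * itg (Phi ^~ p) c d)%:E) =
  (fun p => \int[leb]_t f (p, t))%E.
  by apply/funext => p; exact: FE.
split; first by rewrite FEf; exact: (integrable_fubini_F (m1 :=
  plane_area R) (m2 := leb) intf).
under eq_integral do rewrite FE.
have GE : (\int[leb]_(t in `[c, d]) \int[area R]_p (wt l p * Phi t p)%:E =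
  \int[leb]_t \int[(plane_area R)]_p f (p, t))%E.
  rewrite integral_mkcond; apply: eq_integral => t _; rewrite patchE.
  case: ifPn => tcd; apply/esym.
    apply: eq_integral => p _; by rewrite /f /= indicE tcd mul1r.
  by apply: integral0_eq => p _; rewrite /f /= indicE (negbTE tcd) mul0r.
by rewrite GE; exact: (Fubini intf).
Qed.

End FubiniInterval.

(** * Complex differentiability with a quadratic remainder *)

Section ComplexExpansion.
Variable R : realType.
Local Notation normc := (@Normc.normc R).
Local Notation Re := complex.Re.
Local Notation Im := complex.Im.
Variable s : rect R.

(** A quadratic remainder, which analytic functions have, reduces stability under products to
    algebra and still implies [holo_at]. *)
Definition cexpand (H : R -> R -> R[i]) (x y : R) := exists D K d,
  [/\ 0 < d, 0 <= K & forall x' y', lft s <= x' <= rgt s ->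
    bot s <= y' <= top s -> normc ((x' - x) +i* (y' - y)) < d ->
    normc (H x' y' - (H x y + D * ((x' - x) +i* (y' - y))))
      <= K * normc ((x' - x) +i* (y' - y)) ^+ 2].

Lemma cexpand_holo H x y : cexpand H x y ->
  holo_at (fun x y => Re (H x y)) (fun x y => Im (H x y)) s x y.
Proof.
move=> [D [K [d [d0 K0 HD]]]]; exists (Re D), (Im D) => e e0.
have K10 : 0 < K + 1 by rewrite ltr_wpDl.
exists (Num.min (d / 2) (e / (K + 1) / 2)).
  by rewrite lt_min !divr_gt0.
move=> x' y' x's y's; rewrite !lt_min => /andP[xd xe] /andP[yd ye].
have := normc_leD ((x' - x) +i* (y' - y)).
have := HD _ _ x's y's.
set u := (x' - x) +i* (y' - y); rewrite /= => HDu nu.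
have ud : normc u < d by apply: le_lt_trans nu _; lra.
have ue : normc u <= e / (K + 1) by apply: le_trans nu _; lra.
have bound : K * normc u ^+ 2 <= e * (`|x' - x| + `|y' - y|).
  apply: (@le_trans _ _ (e * normc u)); last by rewrite ler_wpM2l ?(ltW e0).
  rewrite expr2 mulrA ler_wpM2r ?normc_ge0//.
  rewrite ler_pdivlMr// in ue.
  by have := normc_ge0 u; lra.
have {}HDu := le_trans (HDu ud) bound.
split; apply: le_trans HDu.
- apply: le_trans (le_Re_normc _); rewrite le_eqVlt; apply/orP; left;
    apply/eqP; congr `|_|.
  by rewrite /u; case: (H x' y') (H x y) (D) => [a1 b1] [a2 b2] [a3 b3] /=;
    ring.
- apply: le_trans (le_Im_normc _); rewrite le_eqVlt; apply/orP; left;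
    apply/eqP; congr `|_|.
  by rewrite /u; case: (H x' y') (H x y) (D) => [a1 b1] [a2 b2] [a3 b3] /=;
    ring.
Qed.

Lemma cexpandM A B x y : cexpand A x y -> cexpand B x y ->
  cexpand (fun x y => A x y * B x y) x y.
Proof.
move=> [a [KA [dA [dA0 KA0 HA]]]] [b [KB [dB [dB0 KB0 HB]]]].
pose K := KA * (normc (B x y) + normc b + KB) +
  (normc (A x y) + normc a) * KB + normc a * normc b.
have K0 : 0 <= K.
  by rewrite /K !addr_ge0 ?mulr_ge0 ?addr_ge0 ?normc_ge0.
(* The derivative is given by the Leibniz rule. Keeping [|u| < 1] lets [K] absorb every power of [u]
   beyond the second. *)
exists (a * B x y + A x y * b), K, (Num.min 1 (Num.min dA dB)); split=> //.
  by rewrite !lt_min ltr01 dA0.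
move=> x' y' x's y's; rewrite !lt_min; have := HA _ _ x's y's;
  have := HB _ _ x's y's.
set u := (x' - x) +i* (y' - y) => {}HB {}HA /and3P[u1 /HA {}HA /HB {}HB].
set EA := A x' y' - _ in HA; set EB := B x' y' - _ in HB.
have -> : A x' y' * B x' y' - (A x y * B x y + (a * B x y + A x y * b) * u) =
    EA * (B x y + b * u + EB) + (A x y + a * u) * EB + a * b * (u * u).
  by rewrite /EA /EB; ring.
apply: le_trans (le_normcD _ _) _; rewrite !Normc.normcM.
set n := normc u in HA HB u1 *; have n0 : 0 <= n := normc_ge0 u.
have n21 : n ^+ 2 <= 1 by rewrite expr_le1// ltW.
have h1 : normc (B x y + b * u + EB) <= normc (B x y) + normc b + KB.
  apply: le_trans (le_normcD _ _) _; apply: lerD; last first.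
    by apply: le_trans HB _; rewrite ler_piMr.
  apply: le_trans (le_normcD _ _) _; rewrite lerD2l Normc.normcM -/n.
  by rewrite ler_piMr ?normc_ge0// ltW.
have h2 : normc (A x y + a * u) <= normc (A x y) + normc a.
  apply: le_trans (le_normcD _ _) _; rewrite lerD2l Normc.normcM -/n.
  by rewrite ler_piMr ?normc_ge0// ltW.
have -> : K * n ^+ 2 = KA * n ^+ 2 * (normc (B x y) + normc b + KB) +
  (normc (A x y) + normc a) * (KB * n ^+ 2) + normc a * normc b * (n * n).
  by rewrite /K; ring.
apply: lerD => //; apply: le_trans (le_normcD _ _) _; rewrite !Normc.normcM.
by apply: lerD; apply: ler_pM => //; exact: normc_ge0.
Qed.

End ComplexExpansion.

Section ShiftHolo.
Variables (R : realType) (h : hfun R).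
Local Notation normc := (@Normc.normc R).
Local Notation Re := complex.Re.
Local Notation Im := complex.Im.
Hypothesis ah : analytic h.

Lemma cexpand_at_xy s (X Y x y : R) : 0 < X + x -> (forall x', lft s <= x' ->
  0 < X + x') ->
  cexpand s (fun x' y' => at_xy h (X + x', Y + y')) x y.
Proof.
move=> Xx Xs; have [b [C [r [r0 H]]]] := analytic_expand (halfpt (Y + y) Xx) ah.
exists b, `|C|, r; split=> // x' y' /andP[x's _] _ ur.
have Xx' := Xs x' x's.
rewrite (@at_xyE R h (X + x, Y + y) Xx) (@at_xyE R h (X + x', Y + y') Xx').
have uE : sval (halfpt (Y + y') Xx') - sval (halfpt (Y + y) Xx) =
  (x' - x) +i* (y' - y).
  by rewrite /=; apply/eqP; rewrite eq_complex /=; apply/andP; split;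
    apply/eqP; ring.
have := H (halfpt (Y + y') Xx'); rewrite uE => /(_ ur) hw.
by apply: le_trans hw _; rewrite ler_wpM2r ?sqr_ge0// ler_norm.
Qed.

Lemma normc_conj (z : R[i]) : normc z^*%C = normc z.
Proof. by case: z => x y; rewrite /= sqrrN. Qed.

(** The point is [Z - conj w] with [Z = X + iY] and [w = x' + iy']. The inner and outer conjugations
    undo each other, so the function is analytic in [w], with derivative [- conj b]. *)
Lemma cexpand_conj_at_xy s (X Y x y : R) : 0 < X - x ->
  (forall x', x' <= rgt s -> 0 < X - x') ->
  cexpand s (fun x' y' => (at_xy h (X - x', Y + y'))^*%C) x y.
Proof.
move=> Xx Xs; have [b [C [r [r0 H]]]] := analytic_expand (halfpt (Y + y) Xx) ah.
exists (- b^*%C), `|C|, r; split=> // x' y' /andP[_ x's] _ ur.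
have Xx' := Xs x' x's.
rewrite (@at_xyE R h (X - x, Y + y) Xx) (@at_xyE R h (X - x', Y + y') Xx').
set u := (x' - x) +i* (y' - y) in ur *.
have uE : sval (halfpt (Y + y') Xx') - sval (halfpt (Y + y) Xx) = - u^*%C.
  by rewrite /=; apply/eqP; rewrite eq_complex /=; apply/andP; split;
    apply/eqP; ring.
have nu : normc (- u^*%C) = normc u by rewrite normcN normc_conj.
have := H (halfpt (Y + y') Xx'); rewrite uE nu => /(_ ur) hw.
set h1 := h _ in hw *; set h0 := h _ in hw *.
have conjE (z1 z0 c v : R[i]) :
    z1^*%C - (z0^*%C + - c^*%C * v) = (z1 - (z0 + c * - v^*%C))^*%C.
  by case: z1 z0 c v => [a1 b1] [a2 b2] [a3 b3] [a4 b4]; apply/eqP;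
    rewrite eq_complex /=; apply/andP; split; apply/eqP; ring.
by rewrite conjE normc_conj; apply: le_trans hw _;
  rewrite ler_wpM2r ?sqr_ge0// ler_norm.
Qed.
End ShiftHolo.

Lemma adde_cancelr (R : realDomainType) (x y z : \bar R) :
  z \is a fin_num -> (x + z = y + z -> x = y)%E.
Proof. by move=> fz xyz; rewrite -(addeK x fz) xyz addeK. Qed.

Section ShiftSelfAdjoint.
Variables (R : realType) (l : nat) (F G : hfun R) (a : R).
Local Notation plane := (measurableTypeR R * measurableTypeR R)%type.
Local Notation leb := (@lebesgue_measure R).
Local Notation normc := (@Normc.normc R).
Local Notation Re := complex.Re.
Local Notation Im := complex.Im.
Hypotheses (a0 : 0 <= a) (aF : analytic F) (aG : analytic G).
Hypotheses (sF : sqint l (at_xy F)) (sG : sqint l (at_xy G)).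

(* At [p = (x, y)] this is [F (z + w) * conj (G (z + a - conj w))] with
   [z = x + iy] and [w = s + ie], which is analytic in [w]. *)
Definition shift_pair (s e : R) (p : plane) : R[i] :=
  at_xy F (aff2 1 s e p) * (at_xy G (aff2 1 (a - s) e p))^*%C.

Lemma measurable_shift_pair d (T : measurableType d) (s e : T -> R)
    (p : T -> plane) :
  measurable_fun setT s -> measurable_fun setT e -> measurable_fun setT p ->
  measurable_fun setT (fun t => Re (shift_pair (s t) (e t) (p t))) /\
  measurable_fun setT (fun t => Im (shift_pair (s t) (e t) (p t))).
Proof.
move=> ms me mp.
have mp1 : measurable_fun setT (fun t => (p t).1)
  by exact: (measurableT_comp measurable_fst mp).
have mp2 : measurable_fun setT (fun t => (p t).2)
  by exact: (measurableT_comp measurable_snd mp).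
have mA (s' : T -> R) : measurable_fun setT s' ->
    measurable_fun setT (fun t => aff2 1 (s' t) (e t) (p t)).
  move=> ms'; apply: measurable_fun_pair => /=.
    by apply: measurable_funD => //; apply: measurable_funM.
  by apply: measurable_funD => //; apply: measurable_funM.
have mas : measurable_fun setT (fun t => a - s t) by exact: measurable_funB.
have [FR FI] := measurable_at_xy aF; have [GR GI] := measurable_at_xy aG.
have mF : cmeasurable (fun t => at_xy F (aff2 1 (s t) (e t) (p t))).
  by split; [exact: (measurableT_comp FR (mA _ ms))
            |exact: (measurableT_comp FI (mA _ ms))].
have mG : cmeasurable (fun t => at_xy G (aff2 1 (a - s t) (e t) (p t))).
  by split; [exact: (measurableT_comp GR (mA _ mas))
            |exact: (measurableT_comp GI (mA _ mas))].
by split; [exact: measurable_ReM|exact: measurable_ImM].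
Qed.

Lemma sqint_wsqnorm_fin (u : plane -> R[i]) : sqint l u ->
  wsqnorm l u \is a fin_num.
Proof. by move=> [_ ?]; rewrite ge0_fin_numE// wsqnorm_ge0. Qed.

(** Both factors are shifted to the right, by [s] and by [a - s], and such shifts do not increase
    the norm. The bound is therefore uniform in [s] and [e], as [fubini_itg] requires; [f] will be
    the real or the imaginary part. *)
Lemma shift_pair_bound (f : R[i] -> R) s e : 0 <= s <= a ->
  (forall z, `|f z| <= normc z) ->
  measurable_fun setT (fun p => f (shift_pair s e p)) ->
  (\int[area R]_p `| (wt l p * f (shift_pair s e p))%:E |
    <= (fine (wsqnorm l (at_xy F)) + fine (wsqnorm l (at_xy G)))%:E)%E.
Proof.
move=> /andP[s0 sa] fz mf.
have mF := cmeasurable_aff2 1 s e sF.1; have mG :=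
  cmeasurable_aff2 1 (a - s) e sG.1.
apply: le_trans (le_integral_wt l mf mF mG (fun p => fz _)) _.
rewrite EFinD !fineK ?sqint_wsqnorm_fin//.
have as0 : 0 <= a - s by rewrite subr_ge0.
apply: leeD.
- by have := wsqnorm_aff2 l e ltr01 s0 sF.1; rewrite expr1n mul1e.
- by have := wsqnorm_aff2 l e ltr01 as0 sG.1; rewrite expr1n mul1e.
Qed.

Lemma integrable_shift_pair (f : R[i] -> R) s e : 0 <= s <= a ->
  (forall z, `|f z| <= normc z) ->
  measurable_fun setT (fun p => f (shift_pair s e p)) ->
  (area R).-integrable setT (fun p => (wt l p * f (shift_pair s e p))%:E).
Proof.
move=> sa fz mf; apply/integrableP; split; first exact: measurable_wtM.
exact: le_lt_trans (shift_pair_bound sa fz mf) (ltry _).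
Qed.

Lemma integral_shift_pair (f : R[i] -> R) s e : 0 <= s <= a ->
  (forall z, `|f z| <= normc z) ->
  (forall e, measurable_fun setT (fun p => f (shift_pair s e p))) ->
  (\int[area R]_p (wt l p * f (shift_pair s e p))%:E =
   \int[area R]_p (wt l p * f (shift_pair s 0 p))%:E)%E.
Proof.
move=> sa fz mf.
rewrite [RHS](integral_aff2 0 e ltr01); last exact: integrable_shift_pair.
rewrite expr1n mul1e; apply: eq_integral => p _; congr (_%:E).
rewrite /wt /shift_pair /aff2 /aff1 /= !mul1r !addr0.
by [].
Qed.

Lemma holo_shift_pair (p : plane) x y : 0 < (p.1 : R) -> 0 <= x <= a ->
  holo_at (fun s e => Re (shift_pair s e p)) (fun s e => Im (shift_pair s e p))
    (Rect 0 a 0 1) x y.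
Proof.
move=> p0 /andP[x0 xa]; apply: cexpand_holo.
have -> : (fun s e => shift_pair s e p) =
    (fun s e => at_xy F (p.1 + s, p.2 + e) * (at_xy G (p.1 + a - s,
      p.2 + e))^*%C).
  by apply/funext => s; apply/funext => e;
    rewrite /shift_pair /aff2 /aff1 !mul1r addrA.
apply: cexpandM.
- apply: cexpand_at_xy => //=; first by rewrite ltr_wpDr.
  by move=> x' x'0; rewrite ltr_wpDr.
- apply: cexpand_conj_at_xy => //=; first by rewrite -addrA ltr_wpDr// subr_ge0.
  by move=> x' x'a; rewrite -addrA ltr_wpDr// subr_ge0.
Qed.

Lemma continuous_shift_pair (p : plane) x y : 0 < (p.1 : R) -> 0 <= x <= a ->
  0 <= y <= 1 ->
  {within `[0, 1], continuous (fun e => Re (shift_pair x e p))} /\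
  {within `[0, a], continuous (fun s => Im (shift_pair s y p))}.
Proof.
move=> p0 xa y1.
exact: (@holo_continuous_line R (fun s e => Re (shift_pair s e p))
  (fun s e => Im (shift_pair s e p)) (Rect 0 a 0 1)
  (fun x y xa _ => holo_shift_pair y p0 xa) x y xa y1).
Qed.

Let aa : 0 <= a <= a. Proof. by rewrite a0 lexx. Qed.
Let za : 0 <= (0 : R) <= a. Proof. by rewrite a0 lexx. Qed.
Let z1 : 0 <= (0 : R) <= 1. Proof. by rewrite lexx ler01. Qed.
Let o1 : 0 <= (1 : R) <= 1. Proof. by rewrite lexx ler01. Qed.

(** Arranged as an equality of sums so that integrating over [p] uses only additivity. *)
Lemma shift_pair_goursat (p : plane) : 0 < (p.1 : R) ->
  itg (fun e => Re (shift_pair a e p)) 0 1 +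
    itg (fun s => Im (shift_pair s 0 p)) 0 a =
  itg (fun e => Re (shift_pair 0 e p)) 0 1 +
    itg (fun s => Im (shift_pair s 1 p)) 0 a.
Proof.
move=> p0.
have := @goursat R (fun s e => Re (shift_pair s e p))
  (fun s e => Im (shift_pair s e p)) (Rect 0 a 0 1)
  (fun x y xa _ => holo_shift_pair y p0 xa) a0 ler01.
have [c1 _] := continuous_shift_pair p0 aa z1.
have [c2 c3] := continuous_shift_pair p0 za z1.
have [_ c4] := continuous_shift_pair p0 za o1.
rewrite /= (itgB c1 c2) (itgB c4 c3).
by lra.
Qed.

(** Once integrated over [p], the integrand no longer depends on [e], and the vertical side has
    length 1, so averaging along it returns the value at [e = 0]. *)
Lemma shift_pair_fubini_Re (s : R) : 0 <= s <= a ->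
  (area R).-integrable setT
    (fun p => (wt l p * itg (fun e => Re (shift_pair s e p)) 0 1)%:E) /\
  (\int[area R]_p (wt l p * itg (fun e => Re (shift_pair s e p)) 0 1)%:E =
   \int[area R]_p (wt l p * Re (shift_pair s 0 p))%:E)%E.
Proof.
move=> sa.
have mR e : measurable_fun setT (fun p => Re (shift_pair s e p)).
  by have [] := @measurable_shift_pair _ _ (fun=> s) (fun=> e) (fun p : plane
    => p)
     (measurable_cst _) (measurable_cst _) (@measurable_id _ _ _).
have [|||I E] := @fubini_itg R l (fun e p => Re (shift_pair s e p)) 0 1
   (fine (wsqnorm l (at_xy F)) + fine (wsqnorm l (at_xy G))).
- have [] := @measurable_shift_pair _ _ (fun=> s)
     (fun q : (measurableTypeR R * plane)%type => q.1) (fun q => q.2)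
     (measurable_cst _) measurable_fst measurable_snd => //.
- by move=> t _; apply: shift_pair_bound => //; exact: le_Re_normc.
- move=> p p0; apply: integrable_itv.
  exact: (continuous_shift_pair p0 sa z1).1.
split; first exact: I.
rewrite E.
rewrite (eq_integral (fun=> \int[area R]_p (wt l p * Re (shift_pair s 0
  p))%:E)%E).
  rewrite integral_cst//= lebesgue_measure_itv /= lte_fin ltr01 oppr0 adde0
    mule1.
  by [].
by move=> t _; rewrite (integral_shift_pair (f := @complex.Re R))//;
  exact: le_Re_normc.
Qed.

(** The right-hand side does not mention [e]: this is what makes the two horizontal sides contribute
    equally. *)
Lemma shift_pair_fubini_Im (e : R) : 0 <= e <= 1 ->
  (area R).-integrable setT
    (fun p => (wt l p * itg (fun s => Im (shift_pair s e p)) 0 a)%:E) /\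
  (\int[area R]_p (wt l p * itg (fun s => Im (shift_pair s e p)) 0 a)%:E =
   \int[leb]_(s in `[0%R, a]) \int[area R]_p (wt l p * Im (shift_pair s 0
     p))%:E)%E.
Proof.
move=> e1.
have mI s e' : measurable_fun setT (fun p => Im (shift_pair s e' p)).
  by have [] := @measurable_shift_pair _ _ (fun=> s) (fun=> e') (fun p : plane
    => p)
     (measurable_cst _) (measurable_cst _) (@measurable_id _ _ _).
have [|||I E] := @fubini_itg R l (fun s p => Im (shift_pair s e p)) 0 a
   (fine (wsqnorm l (at_xy F)) + fine (wsqnorm l (at_xy G))).
- have [] := @measurable_shift_pair _ _
     (fun q : (measurableTypeR R * plane)%type => q.1) (fun=> e) (fun q => q.2)
     measurable_fst (measurable_cst _) measurable_snd => //.
- by move=> t ta; apply: shift_pair_bound => //; exact: le_Im_normc.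
- move=> p p0; apply: integrable_itv.
  exact: (continuous_shift_pair p0 za e1).2.
split; first exact: I.
rewrite E; apply: eq_integral => t; rewrite inE /= in_itv /= => ta.
by rewrite (integral_shift_pair (f := @complex.Im R))//; exact: le_Im_normc.
Qed.

Lemma shift_selfadjoint_Re :
  (\int[area R]_p (wt l p * Re (shift_pair a 0 p))%:E =
   \int[area R]_p (wt l p * Re (shift_pair 0 0 p))%:E)%E.
Proof.
have [IA EA] := shift_pair_fubini_Re aa; have [I0 E0] :=
  shift_pair_fubini_Re za.
have [J1 F1] := shift_pair_fubini_Im o1; have [J0 F0] :=
  shift_pair_fubini_Im z1.
rewrite -EA -E0.
(* The horizontal contribution must be finite to be cancelled in the extended reals. *)
have fin0 : (\int[area R]_p (wt l p * itg (fun s => Im (shift_pair s 0 p)) 0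
  a)%:E)%E
  \is a fin_num by exact: integrable_fin_num.
have e1 := integralD measurableT IA J0; have e2 := integralD measurableT I0 J1.
suff : (\int[area R]_p (wt l p * itg (fun e => Re (shift_pair a e p)) 0 1)%:E +
    \int[area R]_p (wt l p * itg (fun s => Im (shift_pair s 0 p)) 0 a)%:E =
    \int[area R]_p (wt l p * itg (fun e => Re (shift_pair 0 e p)) 0 1)%:E +
    \int[area R]_p (wt l p * itg (fun s => Im (shift_pair s 0 p)) 0 a)%:E)%E.
  exact: adde_cancelr.
rewrite -[LHS]e1 F0 -F1 -[RHS]e2.
apply: eq_integral => p _; rewrite -!EFinD -!mulrDr.
have [p0|p0] := ltP 0 (p.1 : R); first by rewrite shift_pair_goursat.
by rewrite /wt ltNge p0 !mul0r.
Qed.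

End ShiftSelfAdjoint.

(** * The adjoint of an affine composition operator *)

Section AffineAdjoint.
Variables (R : realType) (l : nat).
Local Notation plane := (measurableTypeR R * measurableTypeR R)%type.
Local Notation normc := (@Normc.normc R).
Local Notation Re := complex.Re.
Local Notation Im := complex.Im.
Implicit Types (f k : hfun R) (p : plane).

Definition affine_map (c : R) (b : R[i]) (g : halfplane R ->
  halfplane R) : Prop :=
  forall w, sval (g w) = c%:C * sval w + b.

Lemma affine_map_exists (c : R) (b : R[i]) : 0 < c -> 0 <= Re b ->
  exists g, affine_map c b g.
Proof.
move=> c0 b0.
have pos (w : halfplane R) : 0 < Re (c%:C * sval w + b).
  case: w b b0 => -[x y] /= x0 [b1 b2] /= b10.
  by rewrite mul0r subr0 ltr_wpDr// mulr_gt0.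
by exists (fun w => exist _ (c%:C * sval w + b) (pos w)).
Qed.

Lemma Re_realM (x : R) (z : R[i]) : Re (x%:C * z) = x * Re z.
Proof. by case: z => z1 z2 /=; rewrite mul0r subr0. Qed.

Lemma Im_realM (x : R) (z : R[i]) : Im (x%:C * z) = x * Im z.
Proof. by case: z => z1 z2 /=; rewrite mul0r addr0. Qed.

Lemma at_xy_comp (c : R) (b : R[i]) g f p : affine_map c b g -> 0 < (p.1 : R) ->
  at_xy (f \o g) p = at_xy f (aff2 c (Re b) (Im b) p).
Proof.
move=> gE p0; rewrite (at_xyE _ p0) /= -at_xy_sval gE; congr (at_xy f _).
have [-> ->] : Re (c%:C * sval (halfpt p.2 p0) + b) = c * p.1 + Re b /\
    Im (c%:C * sval (halfpt p.2 p0) + b) = c * p.2 + Im b.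
  by case: (b) => b1 b2 /=; split; ring.
by [].
Qed.

(** The weight is essential: [aff2] can carry a point outside the half-plane into it, where the left
    value is the junk 0 and the right one is not. *)
Lemma wt_at_xy_comp (c : R) (b : R[i]) g f p (phi : R[i] ->
  R) : affine_map c b g ->
  wt l p * phi (at_xy (f \o g) p) = wt l p * phi (at_xy f (aff2 c (Re b) (Im b)
    p)).
Proof.
move=> gE; have [p0|p0] := ltP 0 (p.1 : R); first by rewrite (at_xy_comp _ gE).
by rewrite /wt ltNge p0 !mul0r.
Qed.

Lemma wsqnorm_comp (c : R) (b : R[i]) g f : affine_map c b g ->
  wsqnorm l (at_xy (f \o g)) = wsqnorm l (at_xy f \o aff2 c (Re b) (Im b)).
Proof.
move=> gE; apply: eq_integral => p _; congr EFin.
exact: (wt_at_xy_comp f p (fun z => normc z ^+ 2) gE).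
Qed.

Lemma bergman_comp (c : R) (b : R[i]) g f : 0 < c -> 0 <= Re b ->
  affine_map c b g ->
  bergman l f -> bergman l (f \o g).
Proof.
move=> c0 b0 gE Bf; have [af _] := Bf; split.
  exact: analytic_comp_affine c0 gE af.
rewrite sqnorm_lty (wsqnorm_comp f gE).
by have [] := sqint_aff2 (Im b) c0 b0 (bergman_sqint Bf).
Qed.

Lemma at_xyZ (c : R[i]) f p : at_xy (c *: f) p = c * at_xy f p.
Proof. by rewrite /at_xy; case: insubP => [//|_]; rewrite mulr0. Qed.

Lemma bergmanZ (c : R[i]) f : bergman l f -> bergman l (c *: f).
Proof.
move=> Bf; have [af _] := Bf; split; first exact: analyticZ.
have [mf foo] := bergman_sqint Bf.
rewrite sqnorm_lty /wsqnorm.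
rewrite (_ : (fun p => _) = (fun p => (normc c ^+ 2)%:E * (wt l p * normc
  (at_xy f p) ^+ 2)%:E)%E); last first.
  by apply/funext => p; rewrite at_xyZ Normc.normcM exprMn -EFinM mulrCA.
rewrite ge0_integralZl//.
- by rewrite lte_mul_pinfty// lee_fin sqr_ge0.
- exact: measurable_wtM (cmeasurable_normc2 mf).
- by move=> p _; rewrite lee_fin mulr_ge0 ?wt_ge0 ?sqr_ge0.
- by rewrite lee_fin sqr_ge0.
Qed.

Lemma integral_shift_Re f k (a : R) : 0 <= a -> bergman l f -> bergman l k ->
  (\int[area R]_p (wt l p * Re (at_xy f (aff2 1 a 0 p) * (at_xy k p)^*%C))%:E =
   \int[area R]_p (wt l p * Re (at_xy f p * (at_xy k (aff2 1 a 0
     p))^*%C))%:E)%E.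
Proof.
move=> a0 Bf Bk; have [[af _] [ak _]] := (Bf, Bk).
have id p : aff2 1 0 0 p = p.
  by case: p => x y; rewrite /aff2 /aff1 /= !mul1r !addr0.
have := shift_selfadjoint_Re a0 af ak (bergman_sqint Bf) (bergman_sqint Bk).
rewrite /shift_pair subrr subr0.
under eq_integral do rewrite id.
by under [in RHS]eq_integral do rewrite id.
Qed.

(** Multiplying [f] by [-i] turns the imaginary part into the real part. *)
Lemma integral_shift_Im f k (a : R) : 0 <= a -> bergman l f -> bergman l k ->
  (\int[area R]_p (wt l p * Im (at_xy f (aff2 1 a 0 p) * (at_xy k p)^*%C))%:E =
   \int[area R]_p (wt l p * Im (at_xy f p * (at_xy k (aff2 1 a 0
     p))^*%C))%:E)%E.
Proof.
move=> a0 Bf Bk.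
have ImE (z w : R[i]) : Im (z * w) = Re (- 'i%C * z * w).
  by case: z w => [x1 y1] [x2 y2] /=; ring.
under eq_integral do rewrite ImE -at_xyZ.
under [in RHS]eq_integral do rewrite ImE -at_xyZ.
exact: integral_shift_Re a0 (bergmanZ _ Bf) Bk.
Qed.

Lemma integral_affine_adjoint (phi : R[i] -> R) (c : R) (b : R[i]) g h f k :
  (forall f k (a : R), 0 <= a -> bergman l f -> bergman l k ->
    (\int[area R]_p (wt l p * phi (at_xy f (aff2 1 a 0 p) * (at_xy k
      p)^*%C))%:E =
     \int[area R]_p (wt l p * phi (at_xy f p * (at_xy k (aff2 1 a 0
       p))^*%C))%:E)%E) ->
  (forall u v, sqint l u -> sqint l v ->
    (area R).-integrable setT (fun p => (wt l p * phi (u p * (v p)^*%C))%:E)) ->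
  0 < c -> 0 <= Re b -> affine_map c b g ->
    affine_map c^-1 (c^-1%:C * b^*%C) h ->
  bergman l f -> bergman l k ->
  (\int[area R]_p (wt l p * phi (at_xy f p * (at_xy (k \o h) p)^*%C))%:E =
   (c ^+ l.+2)%:E *
   \int[area R]_p (wt l p * phi (at_xy (f \o g) p * (at_xy k p)^*%C))%:E)%E.
Proof.
move=> shift int c0 b0 gE hE Bf Bk.
(* Factor [g] as the real translation by [Re b / c] followed by [g1 z = c z + i Im b]. The
   translation passes to [k] by self-adjointness; [g1] maps the half-plane onto itself and is a
   change of variables with factor [c ^+ 2] from the area and [c ^+ l] from the weight. Finally
   [h (g1 z) = z + Re b / c]. *)
have [g1 g1E] : exists g1, affine_map c ((Im b) *i) g1 by exact:
  affine_map_exists.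
have Bf1 : bergman l (f \o g1) by apply: bergman_comp c0 _ g1E Bf.
have cV0 : 0 < c^-1 by rewrite invr_gt0.
have a0 : 0 <= Re b / c by rewrite divr_ge0// ltW.
have Bkh : bergman l (k \o h).
  apply: (bergman_comp cV0 _ hE Bk).
  by rewrite Re_realM mulr_ge0 ?(ltW cV0)//; case: (b) b0.
have -> : (\int[area R]_p (wt l p * phi (at_xy (f \o g) p * (at_xy k
  p)^*%C))%:E =
    \int[area R]_p (wt l p * phi (at_xy (f \o g1) (aff2 1 (Re b / c) 0 p) *
      (at_xy k p)^*%C))%:E)%E.
  apply: eq_integral => p _; congr EFin.
  rewrite (wt_at_xy_comp f p (fun z => phi (z * (at_xy k p)^*%C)) gE).
  have [p0|p0] := ltP 0 (p.1 : R); last by rewrite /wt ltNge p0 !mul0r.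
  rewrite (at_xy_comp f g1E) /=; last by rewrite /aff1 mul1r ltr_wpDr.
  congr (_ * phi (at_xy f _ * _)); rewrite /aff2 /aff1 /=.
  by congr pair; field; rewrite ?gt_eqF.
rewrite shift//.
rewrite (integral_aff2 0 (Im b) c0); last exact: int (bergman_sqint Bf)
  (bergman_sqint Bkh).
have -> : c ^+ l.+2 = c ^+ 2 * c ^+ l by rewrite -exprD.
rewrite (EFinM (c ^+ 2) (c ^+ l)) -muleA; apply: (f_equal (mule (c ^+ 2)%:E)).
rewrite -integralZl//; last first.
  apply: int; first exact: bergman_sqint.
  exact: sqint_aff2 ltr01 a0 (bergman_sqint Bk).
apply: eq_integral => p _; rewrite -EFinM; congr EFin.
have [p0|p0] := ltP 0 (p.1 : R); last first.
  by rewrite /wt /= /aff1 addr0 pmulr_rgt0// ltNge p0 !mul0r mulr0.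
have q0 : 0 < ((aff2 c 0 (Im b) p).1 : R) by rewrite /= /aff1 addr0 mulr_gt0.
rewrite (at_xy_comp f g1E p0) (at_xy_comp k hE q0) Re_realM Im_realM.
have -> : wt l (aff2 c 0 (Im b) p) = c ^+ l * wt l p.
  by rewrite /wt /= /aff1 addr0 pmulr_rgt0// p0 !mul1r exprMn.
rewrite /= -mulrA; congr (_ * (_ * phi (_ * (at_xy k _)^*%C))).
by case: (b) => b1 b2; rewrite /aff2 /aff1 /=; congr pair; field;
  rewrite ?gt_eqF.
Qed.

End AffineAdjoint.

(** * Eigenvectors and contractions *)

Section Positivity.
Variables (R : realType) (l : nat).
Local Notation plane := (measurableTypeR R * measurableTypeR R)%type.
Local Notation leb := (@lebesgue_measure R).
Local Notation normc := (@Normc.normc R).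
Local Notation Re := complex.Re.
Local Notation Im := complex.Im.

Lemma integral_gt0_box (v : plane -> R) (p : plane) (d e : R) :
  measurable_fun setT v -> (forall q, 0 <= v q) -> 0 < d -> 0 < e ->
  (forall q, box_near p d q -> e <= v q) ->
  (0 < \int[area R]_q (v q)%:E)%E.
Proof.
move=> mv v0 d0 e0 ve.
pose I (x : R) : set (measurableTypeR R) := `]x - d, x + d[%classic.
pose B : set plane := I p.1 `*` I p.2.
have mI x : measurable (I x) by exact: measurable_itv.
have mB : measurable B by exact: measurableX.
have lebd (x : R) : leb (I x) = (2 * d)%:E.
  rewrite lebesgue_measure_itv /= lte_fin ifT; last by lra.
  by rewrite -EFinD; congr EFin; ring.
have areaB : area R B = ((2 * d)%:E * (2 * d)%:E)%E.
  transitivity (leb (I p.1) * leb (I p.2))%E; first exact: product_measure1E.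
  by rewrite !lebd.
apply: (@lt_le_trans _ _ (\int[area R]_q (e%:E * (\1_B q)%:E))%E).
  rewrite ge0_integralZl//; last first.
  - by rewrite lee_fin ltW.
  - by apply/measurable_EFinP; exact: measurable_indic.
  rewrite integral_indic// setIT mule_gt0 ?lte_fin// areaB.
  by rewrite -EFinM lte_fin !mulr_gt0.
apply: ge0_le_integral => //.
- by move=> q _; rewrite mule_ge0// lee_fin// ltW.
- by apply: measurable_funeM; apply/measurable_EFinP; exact: measurable_indic.
- exact/measurable_EFinP.
- move=> q _; rewrite indicE -EFinM lee_fin.
  have [qB|_] := boolP (q \in B); last by rewrite mulr0.
  rewrite mulr1; apply: ve; move: qB; rewrite inE /B /I /= !in_itv /= =>
    -[/andP[? ?] /andP[? ?]].
  by split; rewrite ltr_norml; apply/andP; split; lra.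
Qed.

Lemma wt_eq0_analytic (f g : hfun R) : analytic f -> analytic g ->
  (\int[area R]_p (wt l p * normc (at_xy f p - at_xy g p) ^+ 2)%:E = 0)%E ->
    f = g.
Proof.
move=> af ag I0; apply/funext => w; apply/eqP; rewrite -subr_eq0;
  apply/negPn/negP => fg.
(* If [f] and [g] each vary by less than a quarter of [|f w - g w|], their difference stays at least
   [2 * e] in modulus. *)
pose e := normc (f w - g w) / 4.
have n0 : 0 < normc (f w - g w).
  by rewrite lt_neqAle normc_ge0 andbT eq_sym;
    apply: contra fg => /eqP/Normc.eq0_normc ->.
have e0 : 0 < e by rewrite divr_gt0.
have [df df0 Hf] := analytic_near w af e0;
  have [dg dg0 Hg] := analytic_near w ag e0.
pose x := Re (sval w); pose y := Im (sval w).
have x0 : 0 < x := svalP w.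
have : (0 < \int[area R]_p (wt l p * normc (at_xy f p - at_xy g p) ^+ 2)%:E)%E.
  (* The bound [x / 2] on the box keeps it in the half-plane, with weight at least
     [(x / 2) ^+ l]. *)
  apply: (@integral_gt0_box _ (x, y) (Num.min (x / 2) (Num.min (df / 2) (dg /
    2)))
    ((x / 2) ^+ l * (2 * e) ^+ 2)).
  - apply: measurable_funM; first exact: measurable_wt.
    have [fR fI] := measurable_at_xy af; have [gR gI] := measurable_at_xy ag.
    apply: cmeasurable_normc2; split.
      rewrite (_ : (fun _ => _) = (fun p => Re (at_xy f p) - Re (at_xy g p)));
        first exact: measurable_funB.
      by apply/funext => q; case: (at_xy f q) (at_xy g q) => [? ?] [? ?].
    rewrite (_ : (fun _ => _) = (fun p => Im (at_xy f p) - Im (at_xy g p)));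
      first exact: measurable_funB.
    by apply/funext => q; case: (at_xy f q) (at_xy g q) => [? ?] [? ?].
  - by move=> q; rewrite mulr_ge0 ?wt_ge0 ?sqr_ge0.
  - by rewrite !lt_min !divr_gt0.
  - by rewrite mulr_gt0// exprn_gt0// ?mulr_gt0// divr_gt0.
  - move=> q [/=]; rewrite !lt_min => /and3P[qx qf qg] /and3P[qy qf' qg'].
    have q0 : x / 2 < (q.1 : R) by move: qx; rewrite ltr_norml => /andP[]; lra.
    have q00 : 0 < (q.1 : R) by lra.
    have dq : normc (sval (halfpt q.2 q00) - sval w) <= `|(q.1 : R) - x| +
      `|(q.2 : R) - y|.
      apply: le_trans (normc_leD _) _; rewrite /x /y.
      by case: (w) => -[u v].
    apply: ler_pM; rewrite ?exprn_ge0//; [lra|lra| |].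
      by rewrite /wt q00 mul1r lerXn2r ?nnegrE//; lra.
    rewrite lerXn2r ?nnegrE ?normc_ge0//; first by rewrite mulr_ge0 // ltW.
    rewrite !(at_xyE _ q00); set wq := halfpt _ _ in dq *.
    have hf : normc (f wq - f w) < e by apply: Hf; apply: le_lt_trans dq _; lra.
    have hg : normc (g wq - g w) < e by apply: Hg; apply: le_lt_trans dq _; lra.
    have : normc (f w - g w) <= normc (f wq - g wq) + (normc (g wq - g w) +
      normc (f wq - f w)).
      have -> : f w - g w = (f wq - g wq) + ((g wq - g w) - (f wq - f w)) by
        ring.
      apply: le_trans (le_normcD _ _) _; rewrite lerD2l.
      by apply: le_trans (le_normcD _ _) _; rewrite normcN.
    by rewrite /e in hf hg *; lra.
by rewrite I0 ltxx.
Qed.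

End Positivity.

Section KernelContraction.
Variables (R : realType) (l : nat).
Local Notation plane := (measurableTypeR R * measurableTypeR R)%type.
Local Notation leb := (@lebesgue_measure R).
Local Notation normc := (@Normc.normc R).
Local Notation Re := complex.Re.
Local Notation Im := complex.Im.

Lemma integral_oneDsqrV_lty : (\int[leb]_x ((oneDsqr (x : R))^-1)%:E < +oo)%E.
Proof.
rewrite ge0_symfun_integralT//.
- rewrite -set_itvcy integral0y_oneDsqr -EFinM ltry //.
- by move=> x; exact: continuous_oneDsqrV.
- by move=> x /=; rewrite /oneDsqr sqrrN.
Qed.

Lemma measurable_oneDsqrV :
  measurable_fun setT (fun x : measurableTypeR R => (oneDsqr (x : R))^-1).
Proof. by apply: continuous_measurable_fun => x;
  exact: continuous_oneDsqrV. Qed.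

Lemma measurable_oneDsqrV2 : measurable_fun setT
  (fun p : plane => ((oneDsqr (p.1 : R))^-1 * (oneDsqr (p.2 : R))^-1)%:E).
Proof.
have m1 := measurable_oneDsqrV.
apply/measurable_EFinP; apply: measurable_funM.
  exact: measurableT_comp m1 measurable_fst.
exact: measurableT_comp m1 measurable_snd.
Qed.

Lemma integral_oneDsqrV2_lty :
  (\int[area R]_p ((oneDsqr (p.1 : R))^-1 * (oneDsqr (p.2 : R))^-1)%:E < +oo)%E.
Proof.
have mf := measurable_oneDsqrV2; have m1 := measurable_oneDsqrV.
have V0 (x : R) : 0 <= (oneDsqr x)^-1 by rewrite invr_ge0 addr_ge0 ?sqr_ge0.
rewrite [X in (X < _)%E](@fubini_tonelli1 _ _ _ _ _ leb leb _ mf); last first.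
  by move=> p; rewrite lee_fin mulr_ge0.
rewrite (eq_integral (fun x : measurableTypeR R => ((oneDsqr (x : R))^-1)%:E *
   \int[leb]_x ((oneDsqr (x : R))^-1)%:E))%E; last first.
  move=> x _; rewrite /fubini_F /=.
  by rewrite -ge0_integralZl//; exact/measurable_EFinP.
have := integral_oneDsqrV_lty.
have : (0 <= \int[leb]_x ((oneDsqr (x : R))^-1)%:E)%E.
  by apply: integral_ge0 => x _; rewrite lee_fin.
set A := (\int[leb]_x _)%E => A0 Aoo.
rewrite ge0_integralZr//.
- by rewrite lte_mul_pinfty// ge0_fin_numE.
- exact/measurable_EFinP.
Qed.

(** With [N = |z + 1| ^+ 2], the integrand is [x ^+ l / N ^+ l.+2]. Since [N] dominates [x],
    [1 + x ^+ 2] and [1 + y ^+ 2], it is at most the integrable product of the inverses of the last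
    two. *)
Lemma bergman_kernel1 : bergman l (kernel (1 : R[i]) l.+1).
Proof.
split; first by apply: analytic_kernel; rewrite ler01.
rewrite sqnorm_lty /wsqnorm.
have aK : analytic (kernel (1 : R[i]) l.+1) by apply: analytic_kernel;
  rewrite ler01.
apply: le_lt_trans integral_oneDsqrV2_lty.
apply: ge0_le_integral => //.
- by move=> p _; rewrite lee_fin mulr_ge0 ?wt_ge0 ?sqr_ge0.
- exact: measurable_wtM (cmeasurable_normc2 (measurable_at_xy aK)).
- exact: measurable_oneDsqrV2.
- move=> p _; rewrite lee_fin.
  have V0 (x : R) : 0 <= (oneDsqr x)^-1 by rewrite invr_ge0 addr_ge0 ?sqr_ge0.
  have [p0|p0] := ltP 0 (p.1 : R); last by rewrite /wt ltNge p0 !mul0r mulr_ge0.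
  rewrite (at_xyE _ p0) /kernel normcX Normc.normcV exprAC exprVn normc_sqr.
  rewrite /wt p0 mul1r.
  have -> : Re (sval (halfpt p.2 p0) + 1) = (p.1 : R) + 1 by [].
  have -> : Im (sval (halfpt p.2 p0) + 1) = (p.2 : R) by rewrite /= addr0.
  move: (p.1 : R) (p.2 : R) p0 => x y x0.
  set N := (x + 1) ^+ 2 + y ^+ 2.
  have y2 := sqr_ge0 y.
  have xN : x <= N by rewrite /N; nra.
  have x2N : oneDsqr x <= N by rewrite /oneDsqr /N; nra.
  have y2N : oneDsqr y <= N by rewrite /oneDsqr /N; nra.
  have N0 : 0 < N by exact: lt_le_trans xN.
  have xl : x ^+ l <= N ^+ l by rewrite lerXn2r ?nnegrE// ltW.
  apply: (@le_trans _ _ (N ^+ l * N^-1 ^+ l.+2)).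
    by rewrite ler_wpM2r// exprn_ge0// invr_ge0 ltW.
  rewrite exprVn (_ : N ^+ l.+2 = N ^+ l * (N * N)); last by rewrite !exprS;
    ring.
  rewrite invfM mulVKf ?expf_neq0 ?gt_eqF// invfM.
  have x10 : 0 < oneDsqr x by rewrite /oneDsqr ltr_wpDr ?sqr_ge0.
  have y10 : 0 < oneDsqr y by rewrite /oneDsqr ltr_wpDr ?sqr_ge0.
  by rewrite ler_pM ?invr_ge0 ?(ltW N0)// lef_pV2.
Qed.

(** The equation on [b] and [s] says that [-s] is the fixed point of the affine map, so
    [g w + s = c (w + s)]. *)
Lemma kernel_comp (c : R) (b s : R[i]) g m : affine_map c b g ->
  b + s = c%:C * s -> kernel s m \o g = (c^-1 ^+ m.+1)%:C *: kernel s m.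
Proof.
move=> gE bs; apply/funext => w; rewrite /kernel /= gE -addrA bs -mulrDr invfM
  exprMn.
by rewrite !rmorphXn /= fmorphV.
Qed.

(** Reduces to [s = 1] by the map [z |-> (z + i Im s) / Re s], which sends [z + s] to a real
    multiple of the new [z + 1]. *)
Lemma bergman_kernel (s : R[i]) : 0 < Re s -> bergman l (kernel s l.+1).
Proof.
move=> s0; have s0V : 0 < (Re s)^-1 by rewrite invr_gt0.
pose b : R[i] := 0 +i* (Im s / Re s).
have [g gE] : exists g, affine_map (Re s)^-1 b g by apply: affine_map_exists.
have -> : kernel s l.+1 = ((Re s)^-1 ^+ l.+2)%:C *: (kernel 1 l.+1 \o g).
  apply/funext => w.
  transitivity (((Re s)^-1 ^+ l.+2)%:C * kernel 1 l.+1 (g w)); last by [].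
  rewrite /kernel gE -addrA.
  have bs : b + 1 = (Re s)^-1%:C * s.
    rewrite /b; case: (s) s0 => x y /= x0; apply/eqP; rewrite eq_complex /=.
    by apply/andP; split; apply/eqP; field; rewrite gt_eqF.
  rewrite bs -mulrDr invfM exprMn -fmorphV invrK.
  rewrite mulrA -!rmorphXn -rmorphM /= -exprMn mulVf ?expr1n ?mul1r//.
  by rewrite gt_eqF.
apply: bergmanZ; apply: (bergman_comp s0V _ gE bergman_kernel1).
by rewrite lexx.
Qed.

(** [f z] equals [f] at every iterate of [g] on [z]; the iterates tend to [z0], where [f] is
    continuous. *)
Lemma contraction_const (c : R) (b : R[i]) g (f : hfun R) (z0 : halfplane R) :
  0 < c -> c < 1 -> affine_map c b g -> sval (g z0) = sval z0 ->
  analytic f -> f \o g = f -> forall z, f z = f z0.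
Proof.
move=> c0 c1 gE gz0 af fg z; apply/eqP; rewrite -subr_eq0; apply/eqP/normc_le0.
apply/ler_addgt0Pr => e e0; rewrite add0r.
have [d d0 dP] := analytic_near z0 af e0.
have fgn n : f (iter n g z) = f z.
  by elim: n => //= n IH; rewrite -IH -[in RHS]fg.
have gn n : sval (iter n g z) - sval z0 = (c ^+ n)%:C * (sval z - sval z0).
  elim: n => [|n IH]; first by rewrite expr0 mul1r.
  rewrite /= gE -[in LHS]gz0 gE exprS rmorphM /= -mulrA -IH; ring.
suff [n nd] : exists n, c ^+ n * normc (sval z - sval z0) < d.
  rewrite -(fgn n) ltW//; apply: dP.
  by rewrite gn Normc.normcM normc_real ger0_norm// exprn_ge0// ltW.
set D := normc _; have D0 : 0 <= D := normc_ge0 _.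
have /cvgrPdist_lt cn : (fun n => c ^+ n) @ \oo --> (0 : R).
  by apply: cvg_expr; rewrite ger0_norm// ltW.
have dD : 0 < d / (D + 1) by rewrite divr_gt0// ltr_wpDl.
have [N _ /(_ N (leqnn N))] := cn _ dD.
rewrite /= sub0r normrN ger0_norm ?exprn_ge0 ?(ltW c0)// => cN.
exists N; rewrite ltr_pdivlMr ?ltr_wpDl// in cN.
apply: le_lt_trans cN; rewrite ler_wpM2l ?exprn_ge0 ?(ltW c0)//; lra.
Qed.

Lemma contraction_eq0 (c : R) (b : R[i]) g (f : hfun R) :
  0 < c -> c < 1 -> 0 < Re b -> affine_map c b g ->
  bergman l f -> f \o g = f -> f = 0.
Proof.
move=> c0 c1 b0 gE Bf fg; have [af _] := Bf; have [_ foo] := bergman_sqint Bf.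
have c10 : 0 < 1 - c by rewrite subr_gt0.
have z0P : 0 < Re ((1 - c)^-1%:C * b) by rewrite Re_realM mulr_gt0 ?invr_gt0.
pose z0 : halfplane R := exist _ ((1 - c)^-1%:C * b) z0P.
have gz0 : sval (g z0) = sval z0.
  rewrite gE /=; case: (b) => b1 b2; apply/eqP; rewrite eq_complex /=.
  by apply/andP; split; apply/eqP; field; rewrite gt_eqF.
have fz := contraction_const c0 c1 gE gz0 af fg.
(* [f] is constant, so [f (2 z) = f z], while this dilation contracts the
   norm by a factor less than 1. *)
have W0 : wsqnorm l (at_xy f) = 0%E.
  have [mf _] := bergman_sqint Bf.
  have := wsqnorm_aff2 l 0 (ltr0Sn _ 1 : 0 < (2 : R)) (lexx 0) mf.
  have -> : wsqnorm l (at_xy f \o aff2 2 0 0) = wsqnorm l (at_xy f).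
    apply: eq_integral => p _; congr EFin; have [p0|p0] := ltP 0 (p.1 : R);
      last first.
      by rewrite /wt ltNge p0 !mul0r.
    have q0 : 0 < ((aff2 2 0 0 p).1 : R) by rewrite /= /aff1 addr0 mulr_gt0.
    by rewrite /= (at_xyE _ p0) (at_xyE _ q0) fz [f (halfpt _ p0)]fz.
  have := wsqnorm_ge0 l (at_xy f); move: foo;
    case: (wsqnorm _ _) => [r| |]//= _.
  rewrite -EFinM !lee_fin => r0 r2; congr EFin; apply/eqP;
    rewrite eq_le r0 andbT.
  have : 2 <= (2 : R) ^+ l.+2 by rewrite exprS ler_pMr// expr_ge1// ler1n.
  by nra.
have a0 : analytic (0 : hfun R).
  by rewrite -(scale0r f); exact: analyticZ.
apply: (wt_eq0_analytic (l := l) af a0).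
rewrite -[RHS]W0; apply: eq_integral => p _.
by rewrite -(scale0r f) at_xyZ mul0r subr0.
Qed.

End KernelContraction.

(** * Inner products, conjugations and the contradiction *)

Section ComplexSymmetry.
Variables (R : realType) (l : nat).
Local Notation plane := (measurableTypeR R * measurableTypeR R)%type.
Local Notation normc := (@Normc.normc R).
Local Notation Re := complex.Re.
Local Notation Im := complex.Im.

Definition inner_part (phi : R[i] -> R) (f k : hfun R) : \bar R :=
  (\int[area R]_p (wt l p * phi (at_xy f p * (at_xy k p)^*%C))%:E)%E.

Lemma binnerE (f k : hfun R) : binner l f k =
  (pi^-1 * fine (inner_part (@complex.Re R) f k)) +i*
  (pi^-1 * fine (inner_part (@complex.Im R) f k)).
Proof. by rewrite /binner /Rintegral !integral_rhp. Qed.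

Lemma binner_affine_adjoint (c : R) (b : R[i]) g h (f k : hfun R) :
  0 < c -> 0 <= Re b -> affine_map c b g ->
    affine_map c^-1 (c^-1%:C * b^*%C) h ->
  bergman l f -> bergman l k ->
  binner l f (k \o h) = (c ^+ l.+2)%:C * binner l (f \o g) k.
Proof.
move=> c0 b0 gE hE Bf Bk.
have Bfg := bergman_comp c0 b0 gE Bf.
have sfg := bergman_sqint Bfg; have sk := bergman_sqint Bk.
have eR := integral_affine_adjoint (@integral_shift_Re R l) (@integrable_ReM R
  l) c0 b0 gE hE Bf Bk.
have eI := integral_affine_adjoint (@integral_shift_Im R l) (@integrable_ImM R
  l) c0 b0 gE hE Bf Bk.
rewrite !binnerE /inner_part eR eI !fineM//; last 2 first.
- by apply: integrable_fin_num => //; exact: integrable_ImM sfg sk.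
- by apply: integrable_fin_num => //; exact: integrable_ReM sfg sk.
by apply/eqP; rewrite eq_complex /=; apply/andP; split; apply/eqP; ring.
Qed.

Lemma binnerZr (c : R) (f k : hfun R) : bergman l f -> bergman l k ->
  binner l f (c%:C *: k) = c%:C * binner l f k.
Proof.
move=> /bergman_sqint sf /bergman_sqint sk.
have ZE (phi : R[i] -> R) : (forall (x : R) z, phi (x%:C * z) = x * phi z) ->
    (area R).-integrable setT (fun p => (wt l p * phi (at_xy f p * (at_xy k
      p)^*%C))%:E) ->
    fine (inner_part phi f (c%:C *: k)) = c * fine (inner_part phi f k).
  move=> phiZ int; rewrite -[c]/(fine c%:E) -fineM//; last first.
    by apply: integrable_fin_num => //; exact: int.
  rewrite /inner_part -integralZl//; congr fine; apply: eq_integral => p _.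
  rewrite -EFinM; congr EFin; rewrite at_xyZ.
  have -> : at_xy f p * (c%:C * at_xy k p)^*%C =
    c%:C * (at_xy f p * (at_xy k p)^*%C).
    by case: (at_xy f p) (at_xy k p) => [x1 y1] [x2 y2]; apply/eqP;
      rewrite eq_complex /=; apply/andP; split; apply/eqP; ring.
  by rewrite phiZ mulrCA.
rewrite !binnerE !ZE //.
- by apply/eqP; rewrite eq_complex /=; apply/andP; split; apply/eqP; ring.
- exact: Im_realM.
- exact: integrable_ImM sf sk.
- exact: Re_realM.
- exact: integrable_ReM sf sk.
Qed.

(** The hypotheses say that [f - k] is orthogonal to both [f] and [k]; the proof expands the square
    of its norm. Testing against these two vectors is all that uniqueness of an adjoint value
    requires. *)
Lemma binner_diff_eq0 (f k : hfun R) : bergman l f -> bergman l k ->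
  binner l f f = binner l f k -> binner l k f = binner l k k -> f = k.
Proof.
move=> Bf Bk; rewrite !binnerE => -[/eqP ff _] [/eqP kk _].
have pi0 : (pi^-1 : R) != 0 by rewrite invr_neq0// gt_eqF// pi_gt0.
move: ff kk; rewrite !(inj_eq (mulfI pi0)) => /eqP ff /eqP kk.
have [sf sk] := (bergman_sqint Bf, bergman_sqint Bk).
have [[af _] [ak _]] := (Bf, Bk).
apply: (wt_eq0_analytic (l := l) af ak).
have int u v (su : sqint l u) (sv : sqint l v) := integrable_ReM su sv.
have fin (u v : hfun R) (su : sqint l (at_xy u)) (sv : sqint l (at_xy v)) :
   inner_part (@complex.Re R) u v = (fine (inner_part (@complex.Re R) u v))%:E.
  by rewrite fineK//; apply: integrable_fin_num => //; exact: int.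
transitivity ((inner_part (@complex.Re R) f f - inner_part (@complex.Re R) f k)
  +
   (inner_part (@complex.Re R) k k - inner_part (@complex.Re R) k f))%E.
  rewrite /inner_part.
  rewrite -integralB//; [|exact: int|exact: int].
  rewrite -integralB//; [|exact: int|exact: int].
  rewrite -integralD//; [|by apply: integrableB => //;
    exact: int|by apply: integrableB => //; exact: int].
  apply: eq_integral => p _; rewrite -!EFinD; congr EFin; rewrite normc_sqr.
  by case: (at_xy f p) (at_xy k p) => [x1 y1] [x2 y2] /=; ring.
by rewrite (fin f f)// (fin f k)// (fin k k)// (fin k f)// ff kk -!EFinB !subrr
  adde0.
Qed.

Lemma conjugation0 (J : hfun R -> hfun R) : conjugation l J ->
  bergman l (0 : hfun R) -> J 0 = 0.
Proof.
move=> CJ B0; have := conj_antilinear CJ 1 B0 B0.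
rewrite scaler0 addr0 conjc1 scale1r => /eqP.
by rewrite -subr_eq0 opprD addrA subrr sub0r oppr_eq0 => /eqP.
Qed.

Lemma conjugation_eq0 (J : hfun R -> hfun R) k : conjugation l J ->
  bergman l k -> J k = 0 -> k = 0.
Proof.
move=> CJ Bk Jk; have := conj_stable CJ Bk; rewrite Jk => B0.
by rewrite -(conj_involutive CJ Bk) Jk conjugation0.
Qed.

Lemma kernel_neq0 (s : R[i]) m : 0 <= Re s -> kernel s m <> 0.
Proof.
move=> s0 k0; pose w : halfplane R := halfpt 0 (ltr01 : 0 < (1 : R)).
have := congr1 (fun f : hfun R => f w) k0; apply/eqP.
by rewrite /kernel expf_neq0// invr_neq0// halfplane_add_neq0.
Qed.
End ComplexSymmetry.

Theorem corollary8p5 (R : realType) (l : nat) (mu : R) (w0 : R[i])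
    (g : halfplane R -> halfplane R)
    (mu_gt0 : 0 < mu) (mu_neq1 : mu <> 1) (w0_rhp : 0 < complex.Re w0)
    (gE : forall w : halfplane R, sval (g w) = mu%:C * sval w + w0) :
  ~ complex_symmetric l (comp_max l g).
Proof.
move=> [J [CJ TJ]].
have gA : affine_map mu w0 g by [].
have muV0 : 0 < mu^-1 by rewrite invr_gt0.
have w00 := ltW w0_rhp.
have v0 : 0 < complex.Re (mu^-1%:C * w0^*%C).
  by rewrite Re_realM mulr_gt0//; case: (w0) w0_rhp.
have [h hA] := affine_map_exists muV0 (ltW v0).
have [mu1|mu1|//] := ltgtP mu 1.
(* Here [g] is the contraction and [-s] is the fixed point of [h]. The eigenvalue [mu ^+ l.+2]
   cancels the adjoint factor, so the adjoint fixes [K]. *)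
- pose s := (1 - mu)^-1%:C * w0^*%C; pose K := kernel s l.+1.
  have s0 : 0 < complex.Re s.
    by rewrite Re_realM mulr_gt0 ?invr_gt0 ?subr_gt0//; case: (w0) w0_rhp.
  have BK : bergman l K by exact: bergman_kernel.
  have KhE : K \o h = (mu ^+ l.+2)%:C *: K.
    rewrite /K (kernel_comp _ hA) ?invrK//.
    rewrite /s; case: (w0) => x y; apply/eqP; rewrite eq_complex /=.
    have m1 : 1 - mu != 0 by rewrite subr_eq0 gt_eqF.
    by apply/andP; split; apply/eqP; field; rewrite m1 gt_eqF.
  have TK : adjoint l (comp_max l g) K K.
    split=> // f _ [Bf _ ->].
    have := binner_affine_adjoint mu_gt0 w00 gA hA Bf BK.
    rewrite KhE binnerZr// => /mulfI -> //.
    by rewrite eq_complex /= eqxx andbT expf_neq0// gt_eqF.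
  have BJK := conj_stable CJ BK.
  have : comp_max l g (J K) (J K).
    by apply/TJ; split=> //; exists K => //; rewrite (conj_involutive CJ BK).
  move=> [_ _ JKg].
  have JK0 := contraction_eq0 mu_gt0 mu1 w0_rhp gA BJK (esym JKg).
  exact: kernel_neq0 (ltW s0) (conjugation_eq0 CJ BK JK0).
(* Now [g] is the expansion, with fixed point [-s], so [K] is an eigenvector of composition with [g]
   itself and the adjoint is met at [J K]. *)
- pose s := (mu - 1)^-1%:C * w0; pose K := kernel s l.+1.
  have s0 : 0 < complex.Re s.
    by rewrite Re_realM mulr_gt0 ?invr_gt0 ?subr_gt0.
  have BK : bergman l K by exact: bergman_kernel.
  have KgE : K \o g = (mu^-1 ^+ l.+2)%:C *: K.
    rewrite /K (kernel_comp _ gA)//.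
    rewrite /s; case: (w0) => x y; apply/eqP; rewrite eq_complex /=.
    by apply/andP; split; apply/eqP; field; rewrite subr_eq0 gt_eqF.
  have B0 : bergman l (0 : hfun R) by rewrite -(scale0r K); exact: bergmanZ.
  have BJK := conj_stable CJ BK; set f := J K in BJK.
  have : comp_max l g K (K \o g) by split=> //;
    exact: bergman_comp mu_gt0 w00 gA BK.
  move=> /TJ[_ [k' [_ Bk' adj] KgJ]].
  (* Apply [J] to the eigenvalue equation of [K]; the eigenvalue is real, hence unchanged by
     antilinearity. *)
  have k'E : k' = (mu^-1 ^+ l.+2)%:C *: f.
    rewrite -(conj_involutive CJ Bk') -KgJ KgE.
    have := conj_antilinear CJ (mu^-1 ^+ l.+2)%:C BK B0.
    by rewrite addr0 (conjugation0 CJ B0) addr0 conjc_real.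
  have Bfh : bergman l (f \o h) by exact: bergman_comp muV0 (ltW v0) hA BJK.
  (* The adjoint is only a relation, so [f = f \o h] is first obtained weakly, against an arbitrary
     [k]; the factors [mu ^+ l.+2] and [mu^-1 ^+ l.+2] cancel. *)
  have eqf k : bergman l k -> binner l k f = binner l k (f \o h).
    move=> Bk; rewrite (binner_affine_adjoint mu_gt0 w00 gA hA Bk BJK).
    have Bkg := bergman_comp mu_gt0 w00 gA Bk.
    have -> := adj k _ (And3 Bk Bkg erefl); rewrite k'E.
    by rewrite binnerZr// mulrA -rmorphM /= exprVn mulfV ?mul1r// expf_neq0//
      gt_eqF.
  have fh : f = f \o h by apply: (binner_diff_eq0 BJK Bfh); exact: eqf.
  have muV1 : mu^-1 < 1 by rewrite invf_lt1.
  have f0 := contraction_eq0 muV0 muV1 v0 hA BJK (esym fh).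
  exact: kernel_neq0 (ltW s0) (conjugation_eq0 CJ BK f0).
Qed.
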